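(* There exists a non-deterministic $\mathrm{CMSO}[2]$-transduction $\tau$ such that, for every weakly-partitive set system $(U,\mathcal{S})$, represented as the $\{\mathsf{SET}\}$-structure $\mathbb{S}$, whose weakly-partitive tree $(T,\lambda,<)$ is represented as the $\{\mathsf{ancestor},\mathsf{DEGENERATE},\mathsf{betweeness}\}$-structure $\mathbb{T}$, we have $\mathbb{T}\in\tau(\mathbb{S})$, and every output in $\tau(\mathbb{S})$ is (the structure representing) a weakly-partitive tree of $(U,\mathcal{S})$.
   Context: Logic and transductions. Structures over an extended vocabulary consist of a finite universe together with interpretations of relation names (relations on the universe) and of set predicate names (relations on subsets of the universe). $\mathrm{CMSO}[2]$ is monadic second-order logic over such structures extended with a unary set predicate true of a set iff its size is even. A transduction is a set $\tau$ of (input structure, output structure) pairs; $\tau(\mathbb{A})$ is the set of outputs on input $\mathbb{A}$. A $\mathrm{CMSO}[2]$-transduction is a finite composition of atomic transductions: filtering (keep the input unchanged iff it satisfies a fixed sentence); universe restriction (restrict universe and all relations/predicates to the elements satisfying a fixed formula with one free first-order variable); interpretation (same universe, each output symbol $Q$ interpreted as the tuples satisfying a fixed formula with $\mathrm{ar}(Q)$ free variables, first-order for relation names, monadic for set predicate names); copying (for fixed $k$, add $k$ fresh copies of every element and binary relations $\mathsf{copy}_i$ relating each original element to its $i$-th copy); colouring (add a new unary relation interpreted as an arbitrary subset of the universe, every choice yielding an output). It is non-deterministic if it uses colouring. Set systems. A set system is a pair $(U,\mathcal{S})$ with $U$ finite and $\mathcal{S}$ a family of subsets of $U$ with $\emptyset\notin\mathcal{S}$,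 $U\in\mathcal{S}$, $\{a\}\in\mathcal{S}$ for all $a\in U$; it is represented as the $\{\mathsf{SET}\}$-structure with universe $U$ and unary set predicate $\mathsf{SET}$ interpreted as $\mathcal{S}$. Two sets overlap if they intersect and neither contains the other. $(U,\mathcal{S})$ is weakly-partitive if for all overlapping $X,Y\in\mathcal{S}$, the sets $X\cup Y$, $X\cap Y$, $X\setminus Y$, $Y\setminus X$ belong to $\mathcal{S}$. A member is strong if it overlaps no member of $\mathcal{S}$; the strong members $\mathcal{S}_!$ form a laminar family, and its laminar tree $T$ is the rooted tree whose nodes are the members of $\mathcal{S}_!$, root $U$, $X$ a child of $Y$ iff $X\subsetneq Y$ with no member of $\mathcal{S}_!$ strictly between; leaves are the singletons, identified with the elements of $U$. For a node $t$, $L(T_t)$ is the set of leaves that are descendants of $t$. For a set $Z$ with a partial order $<$, $X\subseteq Z$ is a $<$-interval if $<$ is total on $X$ and $a<c<b$ with $a,b\in X$, $c\in Z$ implies $c\in X$. Weakly-partitive tree. A weakly-partitive tree of a weakly-partitive $(U,\mathcal{S})$ is a triple $(T,\lambda,<)$ where $T$ is the laminar tree of $\mathcal{S}_!$, $\lambda$ maps inner nodes to $\{\mathsf{DEGENERATE},\mathsf{PRIME},\mathsf{LINEAR}\}$, and for each inner node $t$ with $\lambda(t)=\mathsf{LINEAR}$, $<_t$ is a linear order of the children of $t$, with $<=\bigcup_{t\in\lambda^{-1}(\mathsf{LINEAR})}<_t$, such that every inner node with exactly two children is labelled $\mathsf{DEGENERATE}$, and: (i) every $X\in\mathcal{S}\setminus\mathcal{S}_!$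 equals $\bigcup_{c\in\mathcal{C}}L(T_c)$ for some node $t$ and set $\mathcal{C}$ of children of $t$ with either $\lambda(t)=\mathsf{DEGENERATE}$, or $\lambda(t)=\mathsf{LINEAR}$ and $\mathcal{C}$ a $<_t$-interval; (ii) conversely for every inner node $t$ and non-empty set $\mathcal{C}$ of children of $t$ such that either $\lambda(t)=\mathsf{DEGENERATE}$, or $\lambda(t)=\mathsf{LINEAR}$ and $\mathcal{C}$ is a $<_t$-interval, $\bigcup_{c\in\mathcal{C}}L(T_c)\in\mathcal{S}$. (Such a tree exists; $T$ and $\lambda$ are unique and each $<_t$ is unique up to reversal.) It is represented by the $\{\mathsf{ancestor},\mathsf{DEGENERATE},\mathsf{betweeness}\}$-structure with universe $V(T)$ (leaves being the elements of $U$), $\mathsf{ancestor}(u,v)$ iff $u$ is an ancestor of $v$ (reflexively), $\mathsf{DEGENERATE}$ the unary relation $\lambda^{-1}(\mathsf{DEGENERATE})$, and $\mathsf{betweeness}$ the ternary relation of triples $(x,y,z)$ with $x<y<z$ or $z<y<x$. *)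

(* Defs.v *)
From HB Require Import structures.
From mathcomp Require Import all_boot.
Set Implicit Arguments.
Unset Strict Implicit.
Unset Printing Implicit Defensive.

(* Relation names are pairs (name, arity) of nats, and so are set       *)
(* predicate names; every structure interprets every symbol (symbols    *)
(* outside its vocabulary are interpreted as empty).                    *)
Record structure := Structure {
  univ  : finType;
  srel  : nat -> forall r : nat, r.-tuple univ -> bool;
  spred : nat -> forall r : nat, r.-tuple {set univ} -> bool }.

(* CMSO[2] formulas (named variables: first-order and monadic ones).    *)
(* FRel q xs : relation name (q, size xs) applied to first-order vars.  *)
(* FSet q Xs : set predicate name (q, size Xs) applied to set vars.     *)
Inductive formula :=
| FRel   of nat & seq nat
| FSet   of nat & seq nat
| FEq    of nat & nat
| FIn    of nat & nat
| FEven  of nat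
| FNot   of formula
| FAnd   of formula & formula
| FEx    of nat & formula
| FExSet of nat & formula.

Definition upd (T : Type) (v : nat -> T) (x : nat) (a : T) : nat -> T :=
  fun n => if n == x then a else v n.

Fixpoint get_all (T : Type) (s : seq (option T)) : option (seq T) :=
  match s with
  | [::] => Some [::]
  | Some a :: s' => if get_all s' is Some l then Some (a :: l) else None
  | None :: _ => None
  end.

(* Satisfaction; an unassigned first-order variable makes atoms false. *)
Fixpoint sat (A : structure) (fv : nat -> option (univ A))
    (sv : nat -> {set univ A}) (f : formula) : bool :=
  match f with
  | FRel q xs =>
      if get_all (map fv xs) is Some s then srel q (in_tuple s) else false
  | FSet q Xs => spred q (in_tuple (map sv Xs))
  | FEq x y =>
      match fv x, fv y with Some a, Some b => a == b | _, _ => false end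
  | FIn x X => if fv x is Some a then a \in sv X else false
  | FEven X => ~~ odd #|sv X|
  | FNot g => ~~ sat fv sv g
  | FAnd g h => sat fv sv g && sat fv sv h
  | FEx x g => [exists a : univ A, sat (upd fv x (Some a)) sv g]
  | FExSet X g => [exists Y : {set univ A}, sat fv (upd sv X Y) g]
  end.

Definition no_fv (A : structure) : nat -> option (univ A) := fun _ => None.
Definition no_sv (A : structure) : nat -> {set univ A} := fun _ => set0.

Definition holds (A : structure) (phi : formula) : bool :=
  sat (@no_fv A) (@no_sv A) phi.
(* formula with free first-order variables 0, ..., r-1 *)
Definition holds_fo (A : structure) (phi : formula) r (t : r.-tuple (univ A)) :=
  sat (fun i => onth t i) (@no_sv A) phi.
(* formula with free monadic variables 0, ..., r-1 *)
Definition holds_mso (A : structure) (phi : formula) r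
    (t : r.-tuple {set univ A}) :=
  sat (@no_fv A) (fun i => nth set0 t i) phi.

Inductive atomic :=
| TFilter   of formula                (* sentence *)
| TRestrict of formula                (* free first-order variable 0 *)
| TInterp   of seq (nat * nat * formula) & seq (nat * nat * formula)
    (* output relation names (q, r) with defining formulas, and output
       set predicate names (q, r) with defining formulas; symbols not
       listed are interpreted as empty *)
| TCopy     of nat & (nat -> nat)
    (* TCopy k c : k copies, copy_i is the binary relation name (c i, 2) *)
| TColour   of nat.                   (* new unary relation name (q, 1) *)

(* a transduction is a finite composition of atomic ones (left first) *)
Definition transduction := seq atomic.

(* An output together with the provenance of its elements: an output
   element is mapped to the input element it *is* (Some a), or to None
   when it is a fresh copy. *)
Definition tracked (A : structure) := {B : structure & univ B -> option (univ A)}.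

Definition lookup (s : seq (nat * nat * formula)) (q r : nat) : option formula :=
  if [seq e <- s | (e.1.1 == q) && (e.1.2 == r)] is e :: _ then Some e.2
  else None.

Section Steps.
Variable A : structure.

Definition restrict_pred (phi : formula) : pred (univ A) :=
  fun a => holds_fo phi [tuple a].

Definition restrict_structure (phi : formula) : structure :=
  @Structure {a : univ A | restrict_pred phi a}
    (fun q r t => srel q (map_tuple val t))
    (fun q r t => spred q (map_tuple
       (fun X : {set {a : univ A | restrict_pred phi a}} => val @: X) t)).

Definition interp_structure (rs ss : seq (nat * nat * formula)) : structure :=
  @Structure (univ A)
    (fun q r t => if lookup rs q r is Some phi then holds_fo phi t else false)
    (fun q r t => if lookup ss q r is Some phi then holds_mso phi t else false).

Definition copy_structure (k : nat) (c : nat -> nat) : structure :=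
  @Structure (univ A * 'I_k.+1)%type
    (fun q r t =>
       if (r == 2) && [exists i : 'I_k.+1, (i != ord0) && (c i == q)] then
         (if val t is [:: x; y] then
            [&& x.2 == ord0, y.1 == x.1, y.2 != ord0 & c y.2 == q]
          else false)
       else all (fun x => x.2 == ord0) t && srel q (map_tuple fst t))
    (fun q r t =>
       all (fun X : {set univ A * 'I_k.+1} =>
              X \subset [set x | x.2 == ord0]) t
       && spred q (map_tuple
            (fun X : {set univ A * 'I_k.+1} => fst @: X) t)).

Definition colour_structure (C : {set univ A}) (c : nat) : structure :=
  @Structure (univ A)
    (fun q r t =>
       if (q == c) && (r == 1) then
         (if val t is [:: a] then a \in C else false)
       else srel q t)
    (@spred A).

(* one atomic step; [C] is the non-deterministic choice (only used by
   colouring); None means the input is rejected (filtering) *)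
Definition step (t : atomic) (C : {set univ A}) : option (tracked A) :=
  match t with
  | TFilter phi =>
      if holds A phi then Some (existT _ A (fun a => Some a)) else None
  | TRestrict phi =>
      Some (existT _ (restrict_structure phi) (fun b => Some (val b)))
  | TInterp rs ss =>
      Some (existT _ (interp_structure rs ss) (fun a => Some a))
  | TCopy k c =>
      Some (existT _ (copy_structure k c)
              (fun x => if x.2 == ord0 then Some x.1 else None))
  | TColour c =>
      Some (existT _ (colour_structure C c) (fun a => Some a))
  end.
End Steps.

Definition tiso (A : structure) (o1 o2 : tracked A) : Prop :=
  exists f : univ (projT1 o1) -> univ (projT1 o2),
    [/\ bijective f,
        forall q r (t : r.-tuple (univ (projT1 o1))),
          srel q (map_tuple f t) = srel q t,
        forall q r (t : r.-tuple {set univ (projT1 o1)}),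
          spred q (map_tuple
            (fun X : {set univ (projT1 o1)} => f @: X) t) = spred q t
      & forall b, projT2 o2 (f b) = projT2 o1 b].

Definition compose_tracked (A : structure) (o1 : tracked A)
    (o2 : tracked (projT1 o1)) : tracked A :=
  existT _ (projT1 o2) (fun b => obind (projT2 o1) (projT2 o2 b)).

Fixpoint run (tau : transduction) (A : structure) (o : tracked A) : Prop :=
  match tau with
  | [::] => tiso (existT _ A (fun a => Some a)) o
  | t :: tau' =>
      exists (C : {set univ A}) (o1 : tracked A),
        step t C = Some o1 /\
        exists o2 : tracked (projT1 o1),
          run tau' o2 /\ tiso (compose_tracked o2) o
  end.

Section SetSystems.
Variable U : finType.
Implicit Types (S : {set {set U}}) (X Y Z : {set U}).

Definition set_system S : Prop :=
  [/\ set0 \notin S, setT \in S & forall a : U, [set a] \in S].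

Definition overlap X Y : bool :=
  [&& X :&: Y != set0, ~~ (X \subset Y) & ~~ (Y \subset X)].

Definition weakly_partitive S : Prop :=
  set_system S /\
  forall X Y, X \in S -> Y \in S -> overlap X Y ->
    [/\ X :|: Y \in S, X :&: Y \in S, X :\: Y \in S & Y :\: X \in S].

Definition strong S X : bool := (X \in S) && [forall Y in S, ~~ overlap X Y].

(* the laminar tree of the strong members: nodes are strong members,
   X is a child of Y iff X is strictly contained in Y with no strong
   member strictly between *)
Definition child S X Y : bool :=
  [&& strong S X, strong S Y, X \proper Y &
      [forall Z, ~~ [&& strong S Z, X \proper Z & Z \proper Y]]].

Definition ancestor S X Y : bool := connect (fun P C => child S C P) X Y.

Definition inner S X : bool := strong S X && [exists C, child S C X].

Definition children S X : {set {set U}} := [set C | child S C X].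

(* L(T_t): leaves (singletons, identified with elements) below t *)
Definition leaves_below S X : {set U} := [set a | ancestor S X [set a]].

Definition is_interval (T : finType) (lt : rel T) (Zs Xs : {set T}) : Prop :=
  Xs \subset Zs /\
  (forall x y, x \in Xs -> y \in Xs -> x != y -> lt x y || lt y x) /\
  (forall a b c, a \in Xs -> b \in Xs -> c \in Zs -> lt a c -> lt c b ->
     c \in Xs).

Inductive label := DEGENERATE | PRIME | LINEAR.

Definition label_eqb (l1 l2 : label) : bool :=
  match l1, l2 with
  | DEGENERATE, DEGENERATE | PRIME, PRIME | LINEAR, LINEAR => true
  | _, _ => false
  end.

(* (T, lam, lt) is a weakly-partitive tree of (U, S); T is the laminar
   tree of the strong members, lam labels the inner nodes, and lt is the
   union of the linear orders <_t of the children of LINEAR nodes t *)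
Definition is_wp_tree S (lam : {set U} -> label) (lt : rel {set U}) : Prop :=
  [/\
      forall X Y, lt X Y ->
        exists t, [/\ inner S t, lam t = LINEAR, child S X t & child S Y t],
      forall t, inner S t -> lam t = LINEAR ->
        [/\ forall X, child S X t -> ~~ lt X X,
            forall X Y Z, child S X t -> child S Y t -> child S Z t ->
              lt X Y -> lt Y Z -> lt X Z
          & forall X Y, child S X t -> child S Y t -> X != Y ->
              lt X Y || lt Y X],
      forall t, inner S t -> #|children S t| = 2 -> lam t = DEGENERATE,
      forall X, X \in S -> ~~ strong S X ->
        exists t (Cs : {set {set U}}),
          [/\ inner S t, Cs \subset children S t,
              X = \bigcup_(c in Cs) leaves_below S c
            & lam t = DEGENERATE \/
              (lam t = LINEAR /\ is_interval lt (children S t) Cs)]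
    &
      forall t (Cs : {set {set U}}), inner S t -> Cs \subset children S t ->
        Cs != set0 ->
        (lam t = DEGENERATE \/
         (lam t = LINEAR /\ is_interval lt (children S t) Cs)) ->
        \bigcup_(c in Cs) leaves_below S c \in S].

(* Symbol names used: SET = set predicate (0, 1);
   ancestor = relation (0, 2), DEGENERATE = relation (1, 1),
   betweeness = relation (2, 3). *)

Definition setsys_structure S : structure :=
  @Structure U (fun _ _ _ => false)
    (fun q r (t : r.-tuple {set U}) =>
       match q, val t with 0, [:: X] => X \in S | _, _ => false end).

(* the {ancestor, DEGENERATE, betweeness}-structure of a wp tree, with
   universe V(T) = strong members; leaves [set a] are the elements a of U *)
Definition tree_structure S (lam : {set U} -> label) (lt : rel {set U})
  : structure :=
  @Structure {X : {set U} | strong S X}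
    (fun q r t =>
       match q, [seq val x | x <- val t] with
       | 0, [:: u; v] => ancestor S u v
       | 1, [:: u] => inner S u && label_eqb (lam u) DEGENERATE
       | 2, [:: x; y; z] => (lt x y && lt y z) || (lt z y && lt y x)
       | _, _ => false
       end)
    (fun _ _ _ => false).

Definition tree_tracked S lam lt : tracked (setsys_structure S) :=
  existT _ (tree_structure S lam lt)
    (fun x => [pick a : U | val x == [set a]]).

End SetSystems.

(* Main.v *)
Require Import Defs.
From mathcomp Require Import all_boot zify.

(* If [t] is linear, then the order of its children is determined by its first
   child and by the relation [btw], which is definable from [S].  Hence "S has a
   weakly-partitive tree" is expressible, and filtering for it makes it
   unnecessary to prove that such a tree exists.

   The nodes are encoded by copies of elements.  Given a set [A] and an element
   [a], let [a] represent the smallest strong set containing [a] that meets [A]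
   in an even number of elements.  Three colours [A] suffice for every inner node
   to be represented: partition [U] in three classes such that each strong set
   meets exactly two of their complements in an odd number of elements.  Then each
   inner node [t] is even for one of the complements, and, the classes being
   suitably chosen, it has a child that is odd for it; going down through odd
   children leads to a representative of [t].  Three more colours select one
   representative of each inner node. *)

Set Implicit Arguments.
Unset Strict Implicit.
Unset Printing Implicit Defensive.

(** * Laminar trees *)

(** The parities come from the Klein four-group. Let [g] take values in its three nonzero elements:
    the parity of [#|X :&: off_class g m|] is the value, at the sum of [g] over [X], of the
    nontrivial character that vanishes at [m]. So a nonzero sum over each strong set makes exactly
    one of the three characters vanish there. Sums add up over children, and a nonzero element is a
    sum of any given number, at least two, of nonzero elements not all equal to it; so sums can be
    prescribed from the root downwards. With one set in place of three, all inner nodes would have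
    to be even, and a node with only inner children would have no representative.

    After copying, set predicates hold of sets of originals only. The tree relations are therefore
    computed first, as set predicates on [U], and then transferred to the copies by naming the set
    that each copy stands for. Colourings need not come from the construction above: the filter
    [f_unique] only asks that each strong set be denoted by exactly one element. *)

Section LaminarTree.
Variables (U : finType) (S : {set {set U}}).
Hypothesis HS : set_system S.
Implicit Types (a b : U) (X Y Z c d t : {set U}) (Cs : {set {set U}}).

Lemma strong_mem X : strong S X -> X \in S.
Proof. by case/andP. Qed.

Lemma strong_neq0 X : strong S X -> X != set0.
Proof.
case: HS => S0 _ _ /strong_mem XS.
by apply: contraNneq S0 => <-.
Qed.

Lemma strong_laminar X Y :
  strong S X -> strong S Y -> [|| X \subset Y, Y \subset X | [disjoint X & Y]].
Proof.
case/andP=> _ /forall_inP ovX /strong_mem YS.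
have := ovX _ YS; rewrite /overlap -setI_eq0.
by case: eqP; case: (X \subset Y); case: (Y \subset X).
Qed.

Lemma strong_meet X Y a :
  strong S X -> strong S Y -> a \in X -> a \in Y -> (X \subset Y) || (Y \subset X).
Proof.
move=> sX sY aX aY; have := strong_laminar sX sY.
by case/or3P=> [->|->|/disjointFr/(_ aX)]; rewrite ?orbT ?aY.
Qed.

Lemma strong_set1 a : strong S [set a].
Proof.
case: HS => _ _ S1; rewrite /strong S1; apply/forall_inP=> Y YS.
rewrite /overlap sub1set; case aY: (a \in Y); first by rewrite !andbF.
suff -> : [set a] :&: Y = set0 by rewrite eqxx.
by apply/eqP; rewrite setI_eq0 disjoints1 aY.
Qed.

Lemma strong_setT : strong S setT.
Proof.
case: HS => _ ST _; rewrite /strong ST; apply/forall_inP=> Y _.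
by rewrite /overlap subsetT !andbF.
Qed.

Lemma childP c t : child S c t ->
  [/\ strong S c, strong S t, c \proper t
    & forall Z, strong S Z -> c \proper Z -> Z \proper t -> False].
Proof.
case/and4P=> sc st ct /forallP m; split=> // Z sZ cZ Zt.
by have := m Z; rewrite sZ cZ Zt.
Qed.

Lemma child_strong c t : child S c t -> strong S c.
Proof. by case/childP. Qed.

Lemma child_proper c t : child S c t -> c \proper t.
Proof. by case/childP. Qed.

Lemma child_sub c t : child S c t -> c \subset t.
Proof. by move/child_proper/proper_sub. Qed.

Lemma child_neq0 c t : child S c t -> exists a, a \in c.
Proof. by move/child_strong/strong_neq0/set0Pn. Qed.

Lemma exists_child X t : strong S X -> strong S t -> X \proper t ->
  exists2 c, child S c t & X \subset c.
Proof.
move=> sX st Xt; pose P Z := strong S Z && (Z \proper t).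
have [|c /maxsetP[/andP[sc ct] cmax] Xc] := @maxset_exists _ P X.
  by rewrite /P sX.
exists c => //; apply/and4P; split=> //; apply/forallP=> Z.
apply/negP=> /and3P[sZ cZ Zt]; have := cmax Z.
by rewrite /P sZ Zt proper_sub // => /(_ isT isT) Zc; rewrite Zc properxx in cZ.
Qed.

Lemma child_max c t Z a : child S c t -> strong S Z -> a \in c -> a \in Z ->
  Z \proper t -> Z \subset c.
Proof.
case/childP=> sc st ct cmax sZ ac aZ Zt.
case/orP: (strong_meet sc sZ ac aZ) => // cZ.
have [->//|cZ'] := eqVneq c Z.
by case: (cmax Z); rewrite // properEneq cZ' cZ.
Qed.

Lemma child_eq c d t a : child S c t -> child S d t -> a \in c -> a \in d -> c = d.
Proof.
move=> ct dt ac ad; apply/eqP; rewrite eqEsubset.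
rewrite (child_max dt (child_strong ct) ad ac (child_proper ct)).
by rewrite (child_max ct (child_strong dt) ac ad (child_proper dt)).
Qed.

(** Two parents share the elements of [c], so they are comparable, and the smaller one would lie
    strictly between [c] and the larger. *)
Lemma child_parent c t t' : child S c t -> child S c t' -> t = t'.
Proof.
move=> ct ct'; have [a ac] := child_neq0 ct.
have [_ st ct1 cm] := childP ct; have [_ st' ct1' cm'] := childP ct'.
have at1 := subsetP (child_sub ct) a ac.
have at1' := subsetP (child_sub ct') a ac.
apply/eqP/negPn/negP=> tt'; case/orP: (strong_meet st st' at1 at1') => tt.
- by apply: (cm' t) => //; rewrite properEneq tt'.
- by apply: (cm t') => //; rewrite properEneq eq_sym tt'.
Qed.

Lemma inner_strong t : inner S t -> strong S t.
Proof. by case/andP. Qed.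

Lemma child_inner c t : child S c t -> inner S t.
Proof. by move=> ct; apply/andP; split; [case/childP: ct | apply/existsP; exists c]. Qed.

(** Singletons are strong, so a strong set with two elements properly contains a strong set and
    hence has a child. *)
Lemma innerE t : inner S t = strong S t && (1 < #|t|).
Proof.
apply/andP/andP=> [] [st]; last first.
  move=> t1; split=> //; have /set0Pn[a at1] := strong_neq0 st.
  have [|c ct _] := exists_child (strong_set1 a) st; last by apply/existsP; exists c.
  by rewrite properEcard sub1set at1 cards1.
case/existsP=> c ct; split=> //; have := proper_card (child_proper ct).
by apply: leq_ltn_trans; rewrite card_gt0 (strong_neq0 (child_strong ct)).
Qed.

Lemma child_cover t a : inner S t -> a \in t -> exists2 c, child S c t & a \in c.
Proof.
rewrite innerE => /andP[st t1] at1.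
have [|c ct] := exists_child (strong_set1 a) st; last by rewrite sub1set; exists c.
by rewrite properEcard sub1set at1 cards1.
Qed.

Lemma other_child t c : child S c t -> exists2 d, child S d t & d != c.
Proof.
move=> ct; have [_ [b bt bc]] := properP (child_proper ct).
have [d dt bd] := child_cover (child_inner ct) bt.
by exists d => //; apply: contraNneq bc => <-.
Qed.

Lemma ancestorE X Y : strong S X -> strong S Y -> ancestor S X Y = (Y \subset X).
Proof.
move=> sX sY; apply/idP/idP=> [/connectP[p] | ].
  elim: p X {sX} => [|Z p IH] X /=; first by move=> _ ->.
  by case/andP=> ZX pZ YE; apply: subset_trans (IH _ pZ YE) (child_sub ZX).
have [n] := ubnP #|X|; elim: n X sX => // n IH X sX Xn YX.
have [->|YX'] := eqVneq Y X; first exact: connect0.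
have [|c cX Yc] := exists_child sY sX; first by rewrite properEneq YX'.
apply: (@connect_trans _ _ c); first exact: connect1.
by apply: IH (child_strong cX) (leq_trans (proper_card (child_proper cX)) _) Yc.
Qed.

Lemma leaves_belowE X : strong S X -> leaves_below S X = X.
Proof.
by move=> sX; apply/setP=> a; rewrite inE ancestorE ?strong_set1 // sub1set.
Qed.

Lemma bigcup_leaves t Cs : Cs \subset children S t ->
  \bigcup_(c in Cs) leaves_below S c = \bigcup_(c in Cs) c.
Proof.
move=> /subsetP Ct; apply: eq_bigr => c /Ct; rewrite inE => /child_strong.
exact: leaves_belowE.
Qed.

(** Children of [t] are non-empty and pairwise disjoint, so a family of them can be read off its
    union. *)
Lemma child_sub_bigcup t Cs c : Cs \subset children S t -> child S c t ->
  (c \subset \bigcup_(d in Cs) d) = (c \in Cs).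
Proof.
move=> /subsetP Ct ct; apply/idP/idP=> [/subsetP cC | cC]; last exact: bigcup_sup cC.
have [a ac] := child_neq0 ct; have /bigcupP[d dC ad] := cC _ ac.
by have := Ct _ dC; rewrite inE => dt; rewrite (child_eq ct dt ac ad).
Qed.

End LaminarTree.

(** * Representing nodes by elements *)

Lemma odd_sum_const (T : finType) (P : pred T) (F : T -> nat) (e : bool) :
  (forall x, P x -> odd (F x) = e) -> odd (\sum_(x | P x) F x) = odd #|P| && e.
Proof.
move=> Fe; rewrite -sum1_card.
apply: (big_rec2 (fun m n : nat => odd m = odd n && e)) => // x n m Px IH.
by rewrite !oddD IH Fe //; case: e {Fe IH}; rewrite ?andbT ?andbF.
Qed.

Section NodeRepresentatives.
Variables (U : finType) (S : {set {set U}}).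
Hypothesis HS : set_system S.
Implicit Types (a b : U) (X Y Z c d t A : {set U}).

Lemma children_partition t : inner S t -> partition (children S t) t.
Proof.
move=> it; apply/and3P; split.
- rewrite eqEsubset; apply/andP; split.
    by apply/bigcupsP=> c; rewrite inE => /child_sub.
  apply/subsetP=> a at1; have [c ct ac] := child_cover HS it at1.
  by apply/bigcupP; exists c; rewrite ?inE.
- apply/trivIsetP=> c d; rewrite !inE => ct dt cd; rewrite -setI_eq0.
  apply/set0Pn=> -[a] /setIP[ac ad].
  by rewrite (child_eq ct dt ac ad) eqxx in cd.
- by rewrite inE; apply/negP=> /(child_neq0 HS)[a]; rewrite inE.
Qed.

Lemma card_children t A : inner S t ->
  #|t :&: A| = \sum_(c | child S c t) #|c :&: A|.
Proof.
move=> it; rewrite -sum1_card.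
under eq_bigl do rewrite inE.
rewrite (set_partition_big_cond _ (children_partition it)) /=.
apply: eq_big => [c|c _]; first by rewrite inE.
by rewrite -sum1_card; apply: eq_bigl => a; rewrite inE.
Qed.

Definition off_class (g : U -> 'I_3) (m : 'I_3) : {set U} := [set a | g a != m].

Definition separating (A : 'I_3 -> {set U}) t :=
  exists m c, [/\ ~~ odd #|t :&: A m|, child S c t & odd #|c :&: A m|].

Lemma eq_off_class X g g' m :
  {in X, g =1 g'} -> X :&: off_class g m = X :&: off_class g' m.
Proof.
by move=> gg; apply/setP=> a; rewrite !inE; case aX: (a \in X); rewrite // (gg _ aX).
Qed.

Lemma exists_classes (i : 'I_3) : exists j l : 'I_3,
  [/\ i != j, i != l, j != l & forall m, [|| m == i, m == j | m == l]].
Proof.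
by case: i => [[|[|[|//]]] ?];
  [exists (@Ordinal 3 1 isT), (@Ordinal 3 2 isT)
  |exists (@Ordinal 3 0 isT), (@Ordinal 3 2 isT)
  |exists (@Ordinal 3 0 isT), (@Ordinal 3 1 isT)]; split=> // -[[|[|[|//]]] ?].
Qed.

(* An even number of children gets the classes [j, l, ..., l] and an odd number
   gets [i, j, ..., j], where [i], [j], [l] are distinct. *)
Lemma exists_child_classes t (i : 'I_3) : inner S t ->
  exists f : {set U} -> 'I_3,
    (forall m (F : {set U} -> nat),
       (forall c, child S c t -> odd (F c) = (m != f c)) ->
       odd (\sum_(c | child S c t) F c) = (m != i)) /\
    (exists2 c, child S c t & f c != i).
Proof.
move=> it; have [_ /existsP[c0 c0t]] := andP it.
have [j [l [ij il jl cases]]] := exists_classes i.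
have [d dt dc0] := other_child HS c0t.
(* [k] leaves out [c0]: an odd [k] means an even number of children. *)
pose k := #|[pred c | child S c t & c != c0]|.
exists (fun c => if c == c0 then if odd k then j else i
                 else if odd k then l else j); split; last first.
  by exists d; rewrite // (negPf dc0); case: ifP; rewrite eq_sym.
move=> m F Fm; rewrite (bigD1 c0) //= oddD Fm // eqxx.
rewrite (@odd_sum_const _ _ _ (m != (if odd k then l else j))); last first.
  by move=> c /andP[ct cc]; rewrite Fm // (negPf cc).
rewrite -/k; case: (odd k) => /=; rewrite ?addbF //.
have [ji li lj] : [/\ j != i, l != i & l != j] by rewrite eq_sym ij eq_sym il eq_sym jl.
by case/or3P: (cases m) => /eqP->; rewrite ?eqxx ?ij ?il ?jl ?ji ?li ?lj.
Qed.

(** The class [i] is prescribed so that the induction can impose on each child the class chosen by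
    [exists_child_classes]. The functions obtained for the children are glued, as the children are
    disjoint. *)
Lemma exists_off_classes X (i : 'I_3) : strong S X ->
  exists g, (forall m, odd #|X :&: off_class g m| = (m != i)) /\
            (forall t, inner S t -> t \subset X -> separating (off_class g) t).
Proof.
have [n] := ubnP #|X|; elim: n X i => // n IH X i Xn sX.
case iX: (inner S X); last first.
  exists (fun=> i); split=> [m|t it tX].
    have X1 : #|X| = 1.
      have := strong_neq0 HS sX; rewrite -card_gt0.
      by move/negbT: iX; rewrite (innerE HS) sX /= -leqNgt; case: #|X| => [|[]].
    have -> : X :&: off_class (fun=> i) m = if m != i then X else set0.
      by apply/setP=> a; rewrite !inE eq_sym; case: eqP; rewrite ?andbF ?andbT ?inE.
    by case: eqP; rewrite /= ?cards0 ?X1.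
  have := subset_leq_card tX; have := it; rewrite innerE // => /andP[_ t1].
  move/(leq_trans t1) => X1; by rewrite (innerE HS) sX X1 in iX.
have [f [fi [c1 c1X fc1]]] := exists_child_classes i iX.
have /fin_all_exists[G GP] : forall c, exists g, child S c X ->
    (forall m, odd #|c :&: off_class g m| = (m != f c)) /\
    (forall t, inner S t -> t \subset c -> separating (off_class g) t).
  move=> c; case cX: (child S c X); last by exists (fun=> i).
  have [|g Hg] := IH c (f c) _ (child_strong cX); last by exists g.
  exact: leq_trans (proper_card (child_proper cX)) _.
(* The default [i] is never reached on [X], which its children cover. *)
pose g a := if [pick c | child S c X && (a \in c)] is Some c then G c a else i.
have gG c : child S c X -> {in c, g =1 G c}.
  move=> cX a ac; rewrite /g; case: pickP => [d /andP[dX ad]|/(_ c)].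
    by rewrite (child_eq dX cX ad ac).
  by rewrite cX ac.
have gc c m : child S c X -> odd #|c :&: off_class g m| = (m != f c).
  by move=> cX; rewrite (eq_off_class _ (gG c cX)); case: (GP c cX).
have gX m : odd #|X :&: off_class g m| = (m != i).
  by rewrite card_children // (fi m) // => c /gc.
exists g; split=> // t it tX; have [->|tX'] := eqVneq t X.
  (* [X] is even exactly for the class [i], and [c1], having another class, is odd for it. *)
  by exists i, c1; rewrite gX eqxx gc // eq_sym.
have [|c cX tc] := exists_child (inner_strong it) sX; first by rewrite properEneq tX'.
have [_ /(_ t it tc)[m [d [te dt dodd]]]] := GP c cX.
exists m, d; rewrite (@eq_off_class t g (G c)) ?(@eq_off_class d g (G c)) //.
  by move=> a ad; apply: gG cX _ (subsetP tc _ (subsetP (child_sub dt) _ ad)).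
by move=> a ad; apply: gG cX _ (subsetP tc _ ad).
Qed.

Definition rep A a X := [&& strong S X, a \in X, ~~ odd #|X :&: A| &
  [forall Y, [&& strong S Y, a \in Y & Y \proper X] ==> odd #|Y :&: A|]].

(** The strong sets containing [a] form a chain, so a minimal even one is the least. *)
Lemma rep_inj A a X Y : rep A a X -> rep A a Y -> X = Y.
Proof.
case/and4P=> sX aX Xe /forallP Xm /and4P[sY aY Ye /forallP Ym].
apply/eqP/negPn/negP=> XY; case/orP: (strong_meet sX sY aX aY) => le.
  by have := Ym X; rewrite sX aX properEneq XY le (negPf Xe).
by have := Xm Y; rewrite sY aY properEneq eq_sym XY le (negPf Ye).
Qed.

(** An odd sum over the children has an odd term; descend into that child until a leaf is
    reached. *)
Lemma exists_odd_branch A c : strong S c -> odd #|c :&: A| ->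
  exists2 a, a \in c &
    forall Y, strong S Y -> a \in Y -> Y \subset c -> odd #|Y :&: A|.
Proof.
have [n] := ubnP #|c|; elim: n c => // n IH c cn sc co.
case ic: (inner S c); last first.
  have /set0Pn[a ac] := strong_neq0 HS sc; exists a => // Y sY aY Yc.
  suff -> : Y = c by [].
  apply/eqP; rewrite eqEcard Yc; move/negbT: ic; rewrite (innerE HS) sc -leqNgt.
  by move/leq_trans; apply; rewrite card_gt0; apply/set0Pn; exists a.
have [d dc dodd] : exists2 d, child S d c & odd #|d :&: A|.
  case: (pickP [pred d | child S d c && odd #|d :&: A|]) => [d /andP[]|no].
    by exists d.
  move: co; rewrite card_children // (@odd_sum_const _ _ _ false) ?andbF // => d dc.
  by have := no d; rewrite /= dc.
have [|a ad aP] := IH d _ (child_strong dc) dodd.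
  exact: leq_trans (proper_card (child_proper dc)) _.
exists a => [|Y sY aY Yc]; first exact: subsetP (child_sub dc) _ ad.
have [->//|Yc'] := eqVneq Y c; apply: aP => //.
by apply: child_max dc sY ad aY _; rewrite properEneq Yc'.
Qed.

Lemma separating_rep (A : 'I_3 -> {set U}) t : strong S t -> separating A t ->
  exists m a, rep (A m) a t.
Proof.
move=> st [m [c [te ct co]]].
have [a ac aP] := exists_odd_branch (child_strong ct) co.
exists m, a; apply/and4P; split=> //; first exact: subsetP (child_sub ct) _ ac.
apply/forallP=> Y; apply/implyP=> /and3P[sY aY Yt].
exact: aP (child_max ct sY ac aY Yt).
Qed.

(* The node that the [i]-th copy of [a] stands for: colours [1], [2], [3] are the
   sets that separate nodes, colours [5], [6], [7] select the used copies. *)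
Definition nodeset (C : nat -> {set U}) (x : U * 'I_4) : {set U} :=
  if x.2 == ord0 then [set x.1] else
  [set b | [exists X, [&& x.1 \in C (x.2 + 4), rep (C x.2) x.1 X & b \in X]]].

(** Leaves are denoted by originals and inner nodes by one selected copy each. The other copies
    denote the empty set, which is not strong, so they do not spoil uniqueness. *)
Lemma exists_nodeset : exists C, forall X, strong S X -> exists x,
  nodeset C x = X /\ forall y, nodeset C y = X -> y = x.
Proof.
have [_ US _] := HS.
have [g [_ gP]] := exists_off_classes ord0 (strong_setT HS).
have /fin_all_exists[r rP] : forall t, exists x : 'I_3 * U,
    inner S t -> rep (off_class g x.1) x.2 t.
  move=> t; case it: (inner S t); last first.
    (* Off the inner nodes any pair will do; [setT] is strong, hence [U] is inhabited. *)
    have /set0Pn[a _] := strong_neq0 HS (strong_setT HS).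
    by exists (ord0, a).
  have [m [a mat]] := separating_rep (inner_strong it) (gP t it (subsetT t)).
  by exists (m, a).
(* Index [m] in ['I_3] belongs to copy [m + 1], with separating colour [m + 1] and selecting colour
   [m + 5]; hence the shifts [n.-1] and [n - 4]. *)
pose C (n : nat) := if n <= 3 then off_class g (inord n.-1)
  else [set a | [exists t, [&& inner S t, (r t).2 == a & (r t).1.+1 == n - 4]]].
have nsE (i : 'I_4) a t : i != ord0 -> inner S t -> r t = (inord i.-1, a) ->
    nodeset C (a, i) = t.
  move=> i0 it rt; have := rP t it; rewrite rt /= => rep_t.
  have iC : C i = off_class g (inord i.-1) by rewrite /C -ltnS ltn_ord.
  rewrite /nodeset /= (negPf i0) iC; apply/setP=> b; rewrite inE.
  apply/idP/idP=> [/existsP[X /and3P[_ rX bX]]|bt]; first by rewrite (rep_inj rep_t rX).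
  apply/existsP; exists t; rewrite rep_t bt andbT /C; case: leqP => [|_]; first by lia.
  rewrite inE andbT; apply/existsP; exists t; rewrite it rt /= eqxx inordK; last first.
    by have := ltn_ord i; lia.
  by move: i0; rewrite -val_eqE /=; lia.
have nsI (i : 'I_4) a b : i != ord0 -> b \in nodeset C (a, i) ->
    exists2 t, inner S t & r t = (inord i.-1, a).
  move=> i0; rewrite /nodeset (negPf i0) inE => /existsP[X /and3P[+ _ _]] /=.
  rewrite /C; case: leqP => [|_]; first by lia.
  rewrite inE => /existsP[t /and3P[it /eqP ra]].
  rewrite addnK => /eqP ri; exists t => //; case: (r t) ra ri => [m b'] /= -> <-.
  by congr (_, _); apply: val_inj; rewrite /= inordK.
have ns1 (i : 'I_4) a t : inner S t -> nodeset C (a, i) = t ->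
    i != ord0 /\ r t = (inord i.-1, a).
  move=> it; have [->|i0 nt] := eqVneq i ord0.
    by rewrite /nodeset eqxx /= => at1; move: it; rewrite innerE // -at1 cards1 andbF.
  split=> //; have /set0Pn[b bt] := strong_neq0 HS (inner_strong it).
  rewrite -nt in bt; have [t' it' rt'] := nsI _ _ _ i0 bt.
  by have := nsE _ _ _ i0 it' rt'; rewrite nt => ->.
exists C => X sX; case iX: (inner S X); last first.
  have [a XE] : exists a, X = [set a].
    apply/cards1P; rewrite eqn_leq card_gt0 (strong_neq0 HS) // andbT.
    by rewrite leqNgt; move: iX; rewrite innerE // sX /= => ->.
  exists (a, ord0); rewrite {1}/nodeset eqxx XE; split=> // -[b i] nX.
  move: (nX); rewrite /nodeset /=; case: eqVneq => [-> /set1_inj -> //|i0 _].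
  have : a \in nodeset C (b, i) by rewrite nX set11.
  case/(nsI _ _ _ i0) => t it rt; have := nsE _ _ _ i0 it rt; rewrite nX -XE => tX.
  by rewrite tX it in iX.
case rX: (r X) => [m a].
have m4 : m.+1 < 4 by rewrite ltnS ltn_ord.
exists (a, Ordinal m4); split.
  by apply: nsE; rewrite // rX; congr (_, _); apply: val_inj; rewrite /= inordK.
move=> [b i] /(ns1 _ _ _ iX)[i0]; rewrite rX => -[mi ->].
congr (_, _); apply: val_inj; rewrite /= mi inordK; last by have := ltn_ord i; lia.
by move: i0; rewrite -val_eqE /=; lia.
Qed.

End NodeRepresentatives.

(** * Definability of the tree *)

Section DefinableTree.
Variables (U : finType) (S : {set {set U}}).
Implicit Types (a b : U) (X Y Z c d t x y z f : {set U}) (Cs : {set {set U}}).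

(** For an inner [t], these are the non-empty unions of children, described by quantifying over sets
    of elements only: a family of children is not a monadic object. *)
Definition splits t X := [&& X != set0, X \subset t &
  [forall c, child S c t ==> (c \subset X) || [disjoint c & X]]].

Definition degenerate t := inner S t && [forall X, splits t X ==> (X \in S)].

(* The last conjunct excludes the children of a prime node. *)
Definition btw x y z := [&& x != y,
  [exists t, [&& child S x t, child S y t & child S z t]],
  [forall Z, [&& Z \in S, x \subset Z & z \subset Z] ==> (y \subset Z)] &
  [exists Z, [&& Z \in S, x \subset Z, y \subset Z & ~~ (z \subset Z)]]].

Definition before f x y := (x != y) && ((x == f) || btw f x y).

(** Rather than minimality of [f], this asks that [before f] be a linear order of the children that
    induces [btw]; irreflexivity is part of [before]. *)
Definition first_child t f := child S f t &&
  [forall x : {set U}, forall y : {set U}, forall z : {set U},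
    [&& child S x t, child S y t & child S z t] ==>
    [&& before f x y && before f y z ==> before f x z,
        (x != y) ==> before f x y || before f y x &
        btw x y z == (before f x y && before f y z) ||
                     (before f z y && before f y x)]].

(** The interval condition in a form that does not depend on the orientation. [btw] makes [y] and
    [z] siblings of [x], so testing the parent of [x] is enough. *)
Definition btw_closed t X := [forall x : {set U}, forall y : {set U}, forall z : {set U},
  [&& child S x t, x \subset X, z \subset X & btw x y z] ==> (y \subset X)].

Definition linear t := [&& inner S t, ~~ degenerate t,
  [exists f, first_child t f] &
  [forall X, splits t X && btw_closed t X ==> (X \in S)]].

(** The first conjunct is condition (i) on weakly-partitive trees; condition (ii) is built into
    [degenerate] and [linear]. The second keeps [btw] within linear nodes, so that it is exactly the
    betweeness of the tree. *)
Definition has_wp_tree :=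
  [forall X, (X \in S) ==> strong S X ||
     [exists t, splits t X && (degenerate t || linear t && btw_closed t X)]] &&
  [forall x : {set U}, forall y : {set U}, forall z : {set U}, btw x y z ==>
     [exists t, child S x t && linear t]].

Hypothesis HS : set_system S.

Definition parts t X := [set c | child S c t & c \subset X].

Lemma parts_children t X : parts t X \subset children S t.
Proof. by apply/subsetP=> c; rewrite !inE => /andP[]. Qed.

(** Together with [splitsE] and [splits_bigcup]: for an inner [t], the sets [X] with [splits t X]
    correspond to the non-empty families of children. *)
Lemma parts_bigcup t Cs : Cs \subset children S t ->
  parts t (\bigcup_(c in Cs) c) = Cs.
Proof.
move=> Ct; apply/setP=> c; rewrite inE; apply/andP/idP=> [[ct]|cC].
  by rewrite (child_sub_bigcup HS Ct).
have ct : child S c t by have := subsetP Ct c cC; rewrite inE.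
by rewrite ct (child_sub_bigcup HS Ct).
Qed.

Lemma splitsE t X : inner S t -> splits t X -> X = \bigcup_(c in parts t X) c.
Proof.
move=> it /and3P[_ Xt /forall_inP sp]; apply/eqP; rewrite eqEsubset andbC.
apply/andP; split; first by apply/bigcupsP=> c; rewrite inE => /andP[].
apply/subsetP=> a aX; have [c ct ac] := child_cover HS it (subsetP Xt a aX).
apply/bigcupP; exists c => //; rewrite inE ct.
by case/orP: (sp c ct) => // /disjointFr/(_ ac); rewrite aX.
Qed.

Lemma splits_bigcup t Cs : Cs \subset children S t -> Cs != set0 ->
  splits t (\bigcup_(c in Cs) c).
Proof.
move=> Ct /set0Pn[c cC]; have ct c' : c' \in Cs -> child S c' t.
  by move=> c'C; have := subsetP Ct c' c'C; rewrite inE.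
apply/and3P; split.
- have [a ac] := child_neq0 HS (ct c cC).
  by apply/set0Pn; exists a; apply/bigcupP; exists c.
- by apply/bigcupsP=> d /ct/child_sub.
- apply/forall_inP=> d dt; rewrite (child_sub_bigcup HS Ct) //.
  case dC: (d \in Cs) => //=; rewrite -setI_eq0; apply/negPn/negP=> /set0Pn[a].
  case/setIP=> ad /bigcupP[e eC ae].
  by rewrite (child_eq dt (ct e eC) ad ae) eC in dC.
Qed.

Lemma parts_neq0 t X : inner S t -> splits t X -> parts t X != set0.
Proof.
move=> it sX; have [X0 _ _] := and3P sX; apply: contraNneq X0 => p0.
by rewrite (splitsE it sX) p0 big_set0.
Qed.

Lemma bigcup_children t : inner S t -> \bigcup_(c in children S t) c = t.
Proof.
move=> it; have /and3P[/eqP + _ _] := children_partition HS it; exact.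
Qed.

(** A non-empty family out of two children has union [t] or is a single child, and both are
    strong. *)
Lemma degenerate_card2 t : inner S t -> #|children S t| = 2 -> degenerate t.
Proof.
move=> it t2; rewrite /degenerate it; apply/forall_inP=> X sX.
rewrite (splitsE it sX); have := subset_leqif_cards (parts_children t X).
have p0 : 0 < #|parts t X| by rewrite card_gt0 parts_neq0.
rewrite t2 => -[]; rewrite leq_eqVlt => /orP[/eqP-> /esym/eqP-> | p2 _].
  by rewrite bigcup_children // strong_mem // inner_strong.
have /cards1P[c pc] : #|parts t X| == 1 by rewrite eqn_leq p0 andbT.
rewrite pc big_set1; have : c \in parts t X by rewrite pc set11.
by rewrite inE => /andP[/child_strong/strong_mem].
Qed.

Lemma btw_parent t x y z : child S x t -> btw x y z -> child S y t /\ child S z t.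
Proof.
move=> xt /and4P[_ /existsP[t' /and3P[xt' yt' zt']] _ _].
by rewrite (child_parent HS xt xt').
Qed.

Definition between (lt : rel {set U}) x y z := (lt x y && lt y z) || (lt z y && lt y x).

(** The tree structure sees [lam] and [lt] only through these two relations, so all trees that agree
    with [S] have the same structure. *)
Definition agrees (lam : {set U} -> label) (lt : rel {set U}) :=
  (forall t, strong S t -> inner S t && label_eqb (lam t) DEGENERATE = degenerate t) /\
  (forall x y z, between lt x y z = btw x y z).

Lemma first_childP t f x y z : first_child t f ->
    child S x t -> child S y t -> child S z t ->
  [/\ before f x y -> before f y z -> before f x z,
      x != y -> before f x y || before f y x
    & btw x y z = between (before f) x y z].
Proof.
case/andP=> _ /forallP/(_ x)/forallP/(_ y)/forallP/(_ z) + xt yt zt.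
rewrite xt yt zt => /and3P[/implyP tr /implyP tot /eqP bt]; split=> // xy yz.
by apply: tr; rewrite xy.
Qed.

(** Labels are read off the definable predicates, and the choice of a first child orients each
    linear node. *)
Lemma has_wp_tree_sound : has_wp_tree ->
  exists lam lt, is_wp_tree S lam lt /\ agrees lam lt.
Proof.
case/andP=> /forall_inP deco /forallP lin3.
pose lam t := if degenerate t then DEGENERATE else if linear t then LINEAR else PRIME.
(* The default [set0] is harmless: a linear node has a first child. *)
pose fst_ t := odflt set0 [pick f | first_child t f].
pose lt x y := [exists t, [&& linear t, child S x t, child S y t & before (fst_ t) x y]].
have lamD t : lam t = DEGENERATE <-> degenerate t.
  by rewrite /lam; case: (degenerate t); case: (linear t).
have lamL t : lam t = LINEAR <-> linear t.
  rewrite /lam; case: ifP => [dt|_]; last by case: ifP.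
  by rewrite /linear dt andbF.
have fstP t : linear t -> first_child t (fst_ t).
  rewrite /fst_ => /and4P[_ _ /existsP[f tf] _].
  by case: pickP => [//|/(_ f)]; rewrite tf.
have ltE t x y : linear t -> child S x t -> child S y t -> lt x y = before (fst_ t) x y.
  move=> lt_ xt yt; apply/existsP/idP=> [[t' /and4P[_ xt' _]]|xy].
    by rewrite (child_parent HS xt xt').
  by exists t; rewrite lt_ xt yt.
have ltP x y : lt x y -> exists t, [/\ linear t, child S x t & child S y t].
  by case/existsP=> t /and4P[]; exists t.
have ltb t x y z : linear t -> child S x t -> child S y t -> child S z t ->
    between lt x y z = btw x y z.
  move=> lt_ xt yt zt; have [_ _ ->] := first_childP (fstP t lt_) xt yt zt.
  by rewrite /between !(ltE t).
exists lam, lt; split; last first.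
  split=> [t st | x y z].
    apply/andP/idP=> [[_]|dt]; first by case E: (lam t) => // _; apply/lamD.
    by have -> : lam t = DEGENERATE by [apply/lamD]; case/andP: dt.
  apply/idP/idP=> [lxyz|bt].
    have [t [lint xt yt zt]] :
        exists t, [/\ linear t, child S x t, child S y t & child S z t].
      case/orP: lxyz => /andP[/ltP[t [lint h1 h2]] /ltP[t' [_ h3 h4]]];
        by exists t; move: h4; rewrite -(child_parent HS h2 h3).
    by rewrite -(ltb t).
  have /forallP/(_ y)/forallP/(_ z) := lin3 x; rewrite bt => /existsP[t /andP[xt lint]].
  by have [yt zt] := btw_parent xt bt; rewrite (ltb t).
split.
- move=> x y /ltP[t [lint xt yt]]; exists t; split=> //; last exact/lamL.
  exact: child_inner xt.
- move=> t it /lamL lint; have fP := first_childP (fstP t lint); split.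
  + by move=> x xt; rewrite (ltE t) // /before eqxx.
  + move=> x y z xt yt zt; rewrite !(ltE t) //; by case: (fP x y z).
  + move=> x y xt yt; rewrite !(ltE t) //; by case: (fP x y y).
- by move=> t it t2; apply/lamD/degenerate_card2.
- move=> X XS nX; have := deco X XS; rewrite (negPf nX) => /existsP[t /andP[sX dl]].
  have it : inner S t by case/orP: dl => [/andP[]|/andP[/and4P[]]].
  exists t, (parts t X); rewrite (bigcup_leaves HS (parts_children t X)).
  split=> //; [exact: parts_children|exact: splitsE|].
  case/orP: dl => [/lamD|/andP[lint /forallP cl]]; [by left|right].
  split; [exact/lamL|split; [exact: parts_children|split]].
    move=> x y; rewrite !inE => /andP[xt _] /andP[yt _] xy; rewrite !(ltE t) //.
    by have [_ ->] := first_childP (fstP t lint) xt yt yt.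
  move=> x z y; rewrite !inE => /andP[xt xX] /andP[zt zX] yt xy yz; rewrite yt /=.
  have /forallP/(_ y)/forallP/(_ z)/implyP := cl x; apply.
  by rewrite xt xX zX -(ltb t) // /between xy yz.
- move=> t Cs it Ct C0; rewrite (bigcup_leaves HS Ct).
  have sX := splits_bigcup Ct C0.
  case=> [/lamD/andP[_ /forall_inP]|[/lamL lint [_ [_ iC]]]]; first exact.
  have /and4P[_ _ _ /forall_inP] := lint; apply; rewrite sX.
  apply/forallP=> x; apply/forallP=> y; apply/forallP=> z; apply/implyP=> /and4P[xt].
  move=> + + xyz; have [yt zt] := btw_parent xt xyz.
  rewrite !(child_sub_bigcup HS Ct) // => xC zC.
  move: xyz; rewrite -(ltb t) // => /orP[/andP[xy yz]|/andP[zy yx]].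
    by apply: (iC x z y); rewrite ?inE.
  by apply: (iC z x y); rewrite ?inE.
Qed.

End DefinableTree.

(** * Comparison of a given weakly-partitive tree with the definable relations *)

Section GivenTree.
Variables (U : finType) (S : {set {set U}}).
Variables (lam : {set U} -> label) (lt : rel {set U}).
Hypothesis HS : set_system S.
Hypothesis HT : is_wp_tree S lam lt.
Implicit Types (a b : U) (X Y Z c d t x y z f : {set U}) (Cs : {set {set U}}).

Lemma lt_child x y : lt x y ->
  exists t, [/\ inner S t, lam t = LINEAR, child S x t & child S y t].
Proof. by case: HT => + _ _ _ _; apply. Qed.

Lemma lt_irr x : lt x x = false.
Proof.
apply/negP=> /[dup] /lt_child[t [it lt_ xt _]].
by case: HT => _ /(_ t it lt_)[/(_ x xt)/negP + _ _] _ _ _.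
Qed.

Lemma lt_trans y x z : lt x y -> lt y z -> lt x z.
Proof.
move=> xy yz; have [t [it lt_ xt yt]] := lt_child xy.
have [t' [_ _ yt' zt]] := lt_child yz.
rewrite -(child_parent HS yt yt') in zt.
by case: HT => _ /(_ t it lt_)[_ /(_ x y z xt yt zt) + _] _ _ _; apply.
Qed.

Lemma lt_total t x y : lam t = LINEAR -> child S x t -> child S y t ->
  [|| x == y, lt x y | lt y x].
Proof.
move=> lt_ xt yt; case: eqVneq => //= xy.
case: HT => _ /(_ t (child_inner xt) lt_)[_ _ +] _ _ _; exact.
Qed.

Definition le x y := (x == y) || lt x y.

Lemma le_lt_trans y x z : le x y -> lt y z -> lt x z.
Proof. by case/orP=> [/eqP->//|]; apply: lt_trans. Qed.

Lemma lt_le_trans y x z : lt x y -> le y z -> lt x z.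
Proof. by move=> xy /orP[/eqP<-//|]; apply: lt_trans xy. Qed.

Lemma bigcup_mem t Cs : inner S t -> Cs \subset children S t -> Cs != set0 ->
  lam t = DEGENERATE \/ lam t = LINEAR /\ is_interval lt (children S t) Cs ->
  \bigcup_(c in Cs) c \in S.
Proof.
move=> it Ct C0 lamt; rewrite -(bigcup_leaves HS Ct).
by case: HT => _ _ _ _ comp; apply: (comp t).
Qed.

Lemma linear_bigcup_mem t Cs : inner S t -> lam t = LINEAR ->
  Cs \subset children S t -> Cs != set0 ->
  (forall a b c : {set U}, a \in Cs -> b \in Cs -> c \in children S t ->
     lt a c -> lt c b -> c \in Cs) ->
  \bigcup_(c in Cs) c \in S.
Proof.
move=> it lt_ Ct C0 iC; apply: (@bigcup_mem t) => //; right; split=> //; split=> [//|].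
split=> // x y xC yC /negPf xy; have := subsetP Ct _ xC; have := subsetP Ct _ yC.
by rewrite !inE => yt xt; have := lt_total lt_ xt yt; rewrite xy.
Qed.

(** A strong [Z] is comparable with [t], hence properly inside it and so inside one child, which
    cannot contain both [x] and [z]. Otherwise the tree presents [Z] as a union of children of some
    [t']. If [t'] is a proper ancestor of [t], its child that contains [t] is included in [Z]; if it
    is a proper descendant, [Z] lies within one child of [t]. Both are impossible, so [t'] is
    [t]. *)
Lemma mem_parts t x z Z : Z \in S -> child S x t -> child S z t -> x != z ->
    x \subset Z -> z \subset Z -> ~~ (t \subset Z) ->
  lam t = DEGENERATE \/ lam t = LINEAR /\ is_interval lt (children S t) (parts S t Z).
Proof.
move=> ZS xt zt xz xZ zZ tZ; have [_ st _ _] := childP xt.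
have [a ax] := child_neq0 HS xt; have [b bz] := child_neq0 HS zt.
have aZ := subsetP xZ a ax; have bZ := subsetP zZ b bz.
have at1 := subsetP (child_sub xt) a ax.
have proper_abs Y : strong S Y -> Z \subset Y -> Y \proper t -> False.
  move=> sY ZY Yt; have [c ct Yc] := exists_child sY st Yt.
  have Zc := subset_trans ZY Yc; case/eqP: xz.
  by rewrite (child_eq xt ct ax (subsetP Zc a aZ)) (child_eq zt ct bz (subsetP Zc b bZ)).
case sZ: (strong S Z).
  have := strong_meet sZ st aZ at1; rewrite (negPf tZ) orbF => Zt.
  case: (proper_abs Z) => //; rewrite properEneq Zt andbT.
  by apply: contraNneq tZ => ->.
have [t' [Cs [it' Ct']]] : exists t' (Cs : {set {set U}}),
    [/\ inner S t', Cs \subset children S t', Z = \bigcup_(c in Cs) leaves_below S c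
      & lam t' = DEGENERATE \/
        lam t' = LINEAR /\ is_interval lt (children S t') Cs].
  by case: HT => _ _ _ + _; apply; rewrite ?sZ.
rewrite (bigcup_leaves HS Ct') => ZE lamt'.
have Zt' : Z \subset t'.
  by rewrite ZE; apply/bigcupsP=> c /(subsetP Ct'); rewrite inE; apply: child_sub.
suff tt' : t = t' by rewrite tt' {1}ZE parts_bigcup.
apply/eqP/negPn/negP=> tt'; have st' := inner_strong it'.
case/orP: (strong_meet st st' at1 (subsetP Zt' a aZ)) => le_t.
  have [|c ct' tc] := exists_child st st'; first by rewrite properEneq tt'.
  have := aZ; rewrite {1}ZE => /bigcupP[d dC ad].
  have dt' : child S d t' by have := subsetP Ct' d dC; rewrite inE.
  have dc := child_eq dt' ct' ad (subsetP tc a at1).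
  by case/negP: tZ; rewrite (subset_trans tc) // ZE -dc (bigcup_sup d).
by apply: (proper_abs t') => //; rewrite properEneq eq_sym tt'.
Qed.

Lemma pair_splits t x z : child S x t -> child S z t ->
  splits S t (x :|: z) /\ parts S t (x :|: z) = [set x; z].
Proof.
move=> xt zt; have <- : \bigcup_(c in [set x; z]) c = x :|: z.
  have [<-|xz] := eqVneq x z; first by rewrite setUid setUid big_set1.
  by rewrite big_setU1 ?inE //= big_set1.
have Ct : [set x; z] \subset children S t.
  by apply/subsetP=> c; rewrite !inE => /orP[]/eqP->.
split; last exact: parts_bigcup.
by apply: splits_bigcup => //; apply/set0Pn; exists x; rewrite set21.
Qed.

Lemma not_sub_pair t x y z : child S x t -> child S y t -> child S z t ->
  x != y -> y != z -> ~~ (y \subset x :|: z).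
Proof.
move=> xt yt zt xy yz; have [_ /setP/(_ y)] := pair_splits xt zt.
by rewrite !inE yt [y == x]eq_sym (negPf xy) (negPf yz) /= => ->.
Qed.

(** For the converse, a node with another label has at least three children. Unions of two children
    being members forces the label LINEAR and leaves no child between two others, which fails for
    three ordered children. *)
Lemma lam_degenerate t : inner S t -> lam t = DEGENERATE <-> degenerate S t.
Proof.
move=> it; split=> [dt|/andP[_ /forall_inP dt]].
  rewrite /degenerate it; apply/forall_inP=> X sX; rewrite (splitsE HS it sX).
  by apply: (bigcup_mem it); rewrite ?parts_children ?parts_neq0 //; left.
have [//|nD] : lam t = DEGENERATE \/ lam t <> DEGENERATE.
  by case: (lam t); [left|right|right].
have [_ /existsP[c1 c1t]] := andP it; have [c2 c2t c21] := other_child HS c1t.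
have [c3 c3t] : exists2 c3, child S c3 t & c3 \notin [set c1; c2].
  case: (pickP [pred c | child S c t & c \notin [set c1; c2]]) => [c /andP[]|no].
    by exists c.
  case: nD; case: HT => _ _ + _ _; apply=> //.
  have <- : #|[set c1; c2]| = 2 by rewrite cards2 eq_sym c21.
  apply: eq_card => c; rewrite inE; apply/idP/idP=> [ct|].
    by have /negbT := no c; rewrite /= ct negbK.
  by rewrite !inE => /orP[]/eqP->.
rewrite !inE negb_or => /andP[c31 c32].
have nb x y z : child S x t -> child S y t -> child S z t -> x != y -> y != z ->
    x != z -> lam t = LINEAR /\ (lt x y -> lt y z -> False).
  move=> xt yt zt xy yz xz; have [sX pX] := pair_splits xt zt.
  have ny := not_sub_pair xt yt zt xy yz.
  have := mem_parts (dt _ sX) xt zt xz (subsetUl _ _) (subsetUr _ _).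
  case; [by apply: contra ny; apply: subset_trans (child_sub yt)|by []|].
  case=> L [_ [_]]; rewrite pX => iv; split=> // xy' yz'.
  have := iv x z y; rewrite !inE !eqxx orbT yt xy' yz' => /(_ isT isT isT isT isT).
  by rewrite (negPf yz) eq_sym (negPf xy).
have [c12 c13 c23] : [/\ c1 != c2, c1 != c3 & c2 != c3].
  by rewrite eq_sym c21 eq_sym c31 eq_sym c32.
have [L n123] := nb c1 c2 c3 c1t c2t c3t c12 c23 c13.
have [_ n132] := nb c1 c3 c2 c1t c3t c2t c13 c32 c12.
have [_ n213] := nb c2 c1 c3 c2t c1t c3t c21 c13 c23.
have [_ n231] := nb c2 c3 c1 c2t c3t c1t c23 c31 c21.
have [_ n312] := nb c3 c1 c2 c3t c1t c2t c31 c12 c32.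
have [_ n321] := nb c3 c2 c1 c3t c2t c1t c32 c21 c31.
have := lt_total L c1t c2t; have := lt_total L c1t c3t; have := lt_total L c2t c3t.
rewrite (negPf c12) (negPf c13) (negPf c23) /=.
(* Any orientation of the three pairs contains a path through all three children, excluded by one of
   the six facts. *)
by case/orP=> h1 /orP[]h2 /orP[]h3; exfalso; intuition.
Qed.

(** By [mem_parts], a member that contains two children of a LINEAR node but not the node itself
    picks out an interval of children; this gives the convexity clause. Conversely, the last clause
    of [btw] rules out PRIME nodes by [mem_parts], and [x :|: z] would be a member violating
    convexity at a DEGENERATE one. At a LINEAR node the closed interval spanned by [x] and [z] is a
    member, so it contains [y]. *)
Lemma between_btw x y z : between lt x y z = btw S x y z.
Proof.
apply/idP/idP.
  have half x' y' z' : lt x' y' -> lt y' z' ->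
      (forall Z, Z \in S -> x' \subset Z -> z' \subset Z -> y' \subset Z) /\
      exists t, [/\ inner S t, lam t = LINEAR, child S x' t & child S y' t /\ child S z' t].
    move=> xy yz; have [t [it lt_ xt yt]] := lt_child xy.
    have [t' [_ _ yt' zt]] := lt_child yz; rewrite -(child_parent HS yt yt') in zt.
    split; last by exists t.
    move=> Z ZS xZ zZ; case tZ: (t \subset Z).
      exact: subset_trans (child_sub yt) tZ.
    have xz : x' != z' by apply: contraTneq (lt_trans xy yz) => ->; rewrite lt_irr.
    case: (mem_parts ZS xt zt xz xZ zZ (negbT tZ)); first by rewrite lt_.
    case=> _ [_ [_ iv]]; have := iv x' z' y'.
    by rewrite !inE xt yt zt xZ zZ => /(_ isT isT isT xy yz)/andP[].
  move=> b_xyz; have [xyz [t [it lt_ xt [yt zt]]]] :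
      (forall Z, Z \in S -> x \subset Z -> z \subset Z -> y \subset Z) /\
      exists t, [/\ inner S t, lam t = LINEAR, child S x t & child S y t /\ child S z t].
    case/orP: b_xyz => /andP[h1 h2]; first exact: half h1 h2.
    have [h [t [it lt_ zt [yt xt]]]] := half _ _ _ h1 h2.
    by split; [move=> Z ZS xZ zZ; apply: h | exists t].
  apply/and4P; split.
  - by apply: contraTneq b_xyz => <-; rewrite /between lt_irr /= andbF.
  - by apply/existsP; exists t; rewrite xt yt zt.
  - by apply/forallP=> Z; apply/implyP=> /and3P[]; apply: xyz.
  (* The children strictly on the side of [z] where [y] lies: their union is a member that contains
     [x] and [y] but not [z]. *)
  pose D := [set c in children S t | if lt y z then lt c z else lt z c].
  have Dt : D \subset children S t by apply/subsetP=> c; rewrite inE => /andP[].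
  have yD : y \in D.
    by rewrite !inE yt; case: ifP b_xyz => //; rewrite /between => ->; rewrite andbF => /andP[].
  have xD : x \in D.
    rewrite !inE xt; case: ifP b_xyz; rewrite /between => yz; last first.
      by rewrite yz andbF => /andP[]; apply: lt_trans.
    case/orP=> /andP[h1 h2]; first exact: lt_trans h1 yz.
    by have := lt_trans h1 yz; rewrite lt_irr.
  apply/existsP; exists (\bigcup_(c in D) c); rewrite !(child_sub_bigcup HS Dt) //.
  rewrite xD yD !inE lt_irr if_same andbF !andbT.
  apply: (linear_bigcup_mem it lt_ Dt); first by apply/set0Pn; exists x.
  move=> a b c; rewrite !inE => /andP[_ ha] /andP[_ hb] -> ac cb.
  by move: ha hb; case: ifP => _ ha hb; [apply: lt_trans cb hb|apply: lt_trans ha ac].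
case/and4P=> xy /existsP[t /and3P[xt yt zt]] /forallP all_Z /existsP[Z /and4P[ZS xZ yZ nzZ]].
have it := child_inner xt; have yz : y != z by apply: contraNneq nzZ => <-.
have xz : x != z by apply: contraNneq nzZ => <-.
have tZ : ~~ (t \subset Z) by apply: contra nzZ; apply: subset_trans (child_sub zt).
have ny := not_sub_pair xt yt zt xy yz.
case: (mem_parts ZS xt yt xy xZ yZ tZ) => [dt|[L _]].
  have [/[dup] sX] := pair_splits xt zt.
  have /andP[_ /forall_inP/(_ _ sX) XS] := (lam_degenerate it).1 dt.
  have := all_Z (x :|: z); rewrite XS subsetUl subsetUr /= => h.
  by rewrite h in ny.
have inI x' z' : child S x' t -> child S z' t -> lt x' z' ->
    (forall Z, Z \in S -> x' \subset Z -> z' \subset Z -> y \subset Z) ->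
    le x' y /\ le y z'.
  move=> xt' zt' xz' all_Z'; pose I := [set c in children S t | le x' c && le c z'].
  have It : I \subset children S t by apply/subsetP=> c; rewrite inE => /andP[].
  have xI : x' \in I by rewrite !inE xt' /le eqxx xz' orbT.
  have zI : z' \in I by rewrite !inE zt' /le eqxx xz' !orbT.
  suff IS : \bigcup_(c in I) c \in S.
    have := all_Z' _ IS; rewrite !(child_sub_bigcup HS It) // xI zI => /(_ isT isT).
    by rewrite inE => /and3P[].
  apply: (linear_bigcup_mem it L It); first by apply/set0Pn; exists x'.
  move=> a b c; rewrite !inE => /and3P[_ xa _] /and3P[_ _ bz] -> ac cb.
  by rewrite /le (le_lt_trans xa ac) (lt_le_trans cb bz) !orbT.
have {}all_Z Z' : Z' \in S -> x \subset Z' -> z \subset Z' -> y \subset Z'.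
  by move=> h1 h2 h3; have := all_Z Z'; rewrite h1 h2 h3.
have := lt_total L xt zt; rewrite (negPf xz) /= => /orP[] lxz.
  have [] := inI x z xt zt lxz all_Z.
  by rewrite /le /between (negPf xy) (negPf yz) => /= -> ->.
have [|] := inI z x zt xt lxz; first by move=> Z' h1 h2 h3; apply: all_Z.
by rewrite /le /between eq_sym (negPf yz) eq_sym (negPf xy) => /= -> ->; rewrite orbT.
Qed.

Lemma exists_min t : lam t = LINEAR -> inner S t ->
  exists2 f, child S f t & forall c, child S c t -> c != f -> lt f c.
Proof.
move=> L /andP[_ /existsP[c0 c0t]].
pose m := [arg min_(c < c0 | child S c t) #|[set d | lt d c]|].
exists m; rewrite /m; case: arg_minnP => // f ft fmin c ct cf.
have := lt_total L ft ct; rewrite eq_sym (negPf cf) /= => /orP[//|lcf].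
have := fmin c ct; rewrite leqNgt => /negP[]; apply: proper_card.
apply/properP; split; first by apply/subsetP=> d; rewrite !inE => dc; apply: lt_trans dc lcf.
by exists c; rewrite !inE ?lt_irr.
Qed.

(** The least child is a first child, because [before] from it is [lt] itself. *)
Lemma lam_linear t : inner S t -> lam t = LINEAR -> linear S t.
Proof.
move=> it L; have [f ft fmin] := exists_min L it; apply/and4P; split=> //.
- by apply/negP=> /(lam_degenerate it); rewrite L.
- apply/existsP; exists f; rewrite /first_child ft /=.
  have bE x y : child S x t -> child S y t -> before S f x y = lt x y.
    move=> xt yt; rewrite /before -between_btw /between.
    have [->|xy] := eqVneq x y; first by rewrite lt_irr.
    have [xf|xf] := eqVneq x f.
      have fy : lt f y by apply: fmin => //; rewrite -xf eq_sym.
      by rewrite xf fy.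
    rewrite fmin //=; case xy': (lt x y) => //=; apply/negP=> /andP[yx xf'].
    by have := lt_trans xf' (fmin _ xt xf); rewrite lt_irr.
  apply/forallP=> x; apply/forallP=> y; apply/forallP=> z; apply/implyP=> /and3P[xt yt zt].
  rewrite !bE // -between_btw eqxx andbT; apply/andP; split.
    by apply/implyP=> /andP[]; apply: lt_trans.
  by apply/implyP=> /negPf xy; have := lt_total L xt yt; rewrite xy.
apply/forallP=> X; apply/implyP=> /andP[sX /forallP cl]; rewrite (splitsE HS it sX).
apply: (linear_bigcup_mem it L); rewrite ?parts_children ?parts_neq0 //.
move=> x z y; rewrite !inE => /andP[xt xX] /andP[zt zX] yt xy yz; rewrite yt.
have /forallP/(_ y)/forallP/(_ z)/implyP := cl x; apply.
by rewrite xt xX zX -between_btw /between xy yz.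
Qed.

Lemma has_wp_tree_complete : has_wp_tree S /\ agrees S lam lt.
Proof.
split; last first.
  split=> [t st|]; last exact: between_btw.
  apply/andP/idP=> [[it]|dt]; first by case E: (lam t) => // _; apply/(lam_degenerate it).
  by have it := andP dt; have := (lam_degenerate it.1).2 dt => ->; case: it.
apply/andP; split; last first.
  apply/forallP=> x; apply/forallP=> y; apply/forallP=> z; apply/implyP.
  rewrite -between_btw => /orP[]/andP[h1 h2].
    have [t [it L xt _]] := lt_child h1.
    by apply/existsP; exists t; rewrite xt lam_linear.
  have [t [it L _ xt]] := lt_child h2.
  by apply/existsP; exists t; rewrite xt lam_linear.
apply/forall_inP=> X XS; case sX: (strong S X) => //=.
have [t [Cs [it Ct]]] : exists t (Cs : {set {set U}}),
    [/\ inner S t, Cs \subset children S t, X = \bigcup_(c in Cs) leaves_below S c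
      & lam t = DEGENERATE \/
        lam t = LINEAR /\ is_interval lt (children S t) Cs].
  by case: HT => _ _ _ + _; apply; rewrite ?sX.
rewrite (bigcup_leaves HS Ct) => XE lamt.
have C0 : Cs != set0.
  have [S0 _ _] := HS; apply: contraNneq S0 => C0.
  by move: XS; rewrite XE C0 big_set0.
apply/existsP; exists t; rewrite XE splits_bigcup //=.
case: lamt => [/(lam_degenerate it)->//|[L [_ [_ iv]]]].
rewrite lam_linear //=; apply/orP; right.
apply/forallP=> x; apply/forallP=> y; apply/forallP=> z; apply/implyP=> /and4P[xt].
move=> + + xyz; have [yt zt] := btw_parent HS xt xyz.
rewrite !(child_sub_bigcup HS Ct) // => xC zC.
move: xyz; rewrite -between_btw => /orP[/andP[xy yz]|/andP[zy yx]].
  by apply: (iv x z y); rewrite ?inE.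
by apply: (iv z x y); rewrite ?inE.
Qed.

End GivenTree.

(** * Formulas *)

(* [locked] keeps rewriting with [sat_not] and [sat_and] from seeing through these
   abbreviations.  A bound set variable is always larger than the free ones; the
   bound first-order variable [0] is harmless where only set variables are free. *)
Definition FOr f g :=
  locked (FNot (FAnd (FNot f) (FNot g))).
Definition FImp f g :=
  locked (FNot (FAnd f (FNot g))).
Definition FIff f g :=
  locked (FAnd (FImp f g) (FImp g f)).
Definition FAll x f :=
  locked (FNot (FEx x (FNot f))).
Definition FAllSet X f :=
  locked (FNot (FExSet X (FNot f))).
Definition f_mem X :=
  locked (FSet 0 [:: X]).
Definition f_sub X Y :=
  locked (FAll 0 (FImp (FIn 0 X) (FIn 0 Y))).
Definition f_eq X Y :=
  locked (FAnd (f_sub X Y) (f_sub Y X)).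
Definition f_proper X Y :=
  locked (FAnd (f_sub X Y) (FNot (f_sub Y X))).
Definition f_meet X Y :=
  locked (FEx 0 (FAnd (FIn 0 X) (FIn 0 Y))).
Definition f_nonempty X :=
  locked (FEx 0 (FIn 0 X)).
Definition f_overlap X Y :=
  locked (FAnd (f_meet X Y) (FAnd (FNot (f_sub X Y)) (FNot (f_sub Y X)))).
Definition f_strong X :=
  locked (FAnd (f_mem X) (FAllSet X.+1 (FImp (f_mem X.+1) (FNot (f_overlap X X.+1))))).
Definition f_child X Y := let Z := (X + Y).+1 in
  locked (FAnd (f_strong X) (FAnd (f_strong Y) (FAnd (f_proper X Y)
    (FAllSet Z (FNot (FAnd (f_strong Z) (FAnd (f_proper X Z) (f_proper Z Y)))))))).
Definition f_inner X :=
  locked (FAnd (f_strong X) (FExSet X.+1 (f_child X.+1 X))).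
Definition f_splits t X := let c := (t + X).+1 in
  locked (FAnd (f_nonempty X) (FAnd (f_sub X t)
    (FAllSet c (FImp (f_child c t) (FOr (f_sub c X) (FNot (f_meet c X))))))).
Definition f_degenerate t :=
  locked (FAnd (f_inner t) (FAllSet t.+1 (FImp (f_splits t t.+1) (f_mem t.+1)))).
Definition f_btw x y z := let Z := (x + y + z).+1 in
  locked (FAnd (FNot (f_eq x y))
    (FAnd (FExSet Z (FAnd (f_child x Z) (FAnd (f_child y Z) (f_child z Z))))
      (FAnd
        (FAllSet Z (FImp (FAnd (f_mem Z) (FAnd (f_sub x Z) (f_sub z Z))) (f_sub y Z)))
        (FExSet Z (FAnd (f_mem Z) (FAnd (f_sub x Z) (FAnd (f_sub y Z) (FNot (f_sub z Z))))))))).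
Definition f_before f x y :=
  locked (FAnd (FNot (f_eq x y)) (FOr (f_eq x f) (f_btw f x y))).
Definition f_first_child t f := let x := (t + f).+1 in let y := x.+1 in let z := y.+1 in
  locked (FAnd (f_child f t) (FAllSet x (FAllSet y (FAllSet z
    (FImp (FAnd (f_child x t) (FAnd (f_child y t) (f_child z t)))
      (FAnd (FImp (FAnd (f_before f x y) (f_before f y z)) (f_before f x z))
      (FAnd (FOr (f_eq x y) (FOr (f_before f x y) (f_before f y x)))
        (FIff (f_btw x y z) (FOr (FAnd (f_before f x y) (f_before f y z))
                                 (FAnd (f_before f z y) (f_before f y x))))))))))).
Definition f_btw_closed t X := let x := (t + X).+1 in let y := x.+1 in let z := y.+1 in
  locked (FAllSet x (FAllSet y (FAllSet z
    (FImp (FAnd (f_child x t) (FAnd (f_sub x X) (FAnd (f_sub z X) (f_btw x y z))))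
      (f_sub y X))))).
Definition f_linear t :=
  locked (FAnd (f_inner t) (FAnd (FNot (f_degenerate t))
    (FAnd (FExSet t.+1 (f_first_child t t.+1))
      (FAllSet t.+1 (FImp (FAnd (f_splits t t.+1) (f_btw_closed t t.+1)) (f_mem t.+1)))))).
Definition f_has_wp_tree :=
  FAnd
    (FAllSet 0 (FImp (f_mem 0) (FOr (f_strong 0) (FExSet 1 (FAnd (f_splits 1 0)
      (FOr (f_degenerate 1) (FAnd (f_linear 1) (f_btw_closed 1 0))))))))
    (FAllSet 0 (FAllSet 1 (FAllSet 2 (FImp (f_btw 0 1 2)
      (FExSet 3 (FAnd (f_child 0 3) (f_linear 3))))))).
(** [FEven] applies to set variables only, so the intersection with colour [i] is first named by
    one. *)
Definition f_even i X :=
  locked (FExSet X.+1 (FAnd (FAll 0 (FIff (FIn 0 X.+1) (FAnd (FIn 0 X) (FRel i [:: 0]))))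
                    (FEven X.+1))).
Definition f_rep i a X :=
  locked (FAnd (f_strong X) (FAnd (FIn a X) (FAnd (f_even i X)
    (FAllSet X.+1 (FImp (FAnd (f_strong X.+1) (FAnd (FIn a X.+1) (f_proper X.+1 X)))
                        (FNot (f_even i X.+1))))))).

(** * Correctness of the formulas *)

Section Satisfaction.
Variable A : structure.
Implicit Types (fv : nat -> option (univ A)) (sv : nat -> {set univ A}).

Lemma upd_eq (T : Type) (v : nat -> T) x a : upd v x a x = a.
Proof. by rewrite /upd eqxx. Qed.

Lemma upd_neq (T : Type) (v : nat -> T) x y a : y <> x -> upd v x a y = v y.
Proof. by move/eqP/negPf; rewrite /upd => ->. Qed.

Lemma sat_not fv sv f : sat fv sv (FNot f) = ~~ sat fv sv f. Proof. by []. Qed.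
Lemma sat_and fv sv f g : sat fv sv (FAnd f g) = sat fv sv f && sat fv sv g.
Proof. by []. Qed.
Lemma sat_or fv sv f g : sat fv sv (FOr f g) = sat fv sv f || sat fv sv g.
Proof. by rewrite /FOr -lock /= negb_and !negbK. Qed.
Lemma sat_imp fv sv f g : sat fv sv (FImp f g) = (sat fv sv f ==> sat fv sv g).
Proof. by rewrite /FImp -lock /= negb_and negbK implybE. Qed.
Lemma sat_iff fv sv f g : sat fv sv (FIff f g) = (sat fv sv f == sat fv sv g).
Proof. by rewrite /FIff -lock sat_and !sat_imp; do 2 case: sat. Qed.
Lemma sat_ex fv sv x f :
  sat fv sv (FEx x f) = [exists a, sat (upd fv x (Some a)) sv f].
Proof. by []. Qed.
Lemma sat_all fv sv x f :
  sat fv sv (FAll x f) = [forall a, sat (upd fv x (Some a)) sv f].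
Proof. by rewrite /FAll -lock /= negb_exists; apply: eq_forallb => a; rewrite negbK. Qed.
Lemma sat_exset fv sv X f :
  sat fv sv (FExSet X f) = [exists Y, sat fv (upd sv X Y) f].
Proof. by []. Qed.
Lemma sat_allset fv sv X f :
  sat fv sv (FAllSet X f) = [forall Y, sat fv (upd sv X Y) f].
Proof. by rewrite /FAllSet -lock /= negb_exists; apply: eq_forallb => a; rewrite negbK. Qed.
Lemma sat_in fv sv x X a : fv x = Some a -> sat fv sv (FIn x X) = (a \in sv X).
Proof. by move=> /= ->. Qed.
Lemma sat_rel2 fv sv q x y a b : fv x = Some a -> fv y = Some b ->
  sat fv sv (FRel q [:: x; y]) = srel q (in_tuple [:: a; b]).
Proof. by move=> /= -> ->. Qed.

Definition satE := (sat_not, sat_and, sat_or, sat_imp, sat_iff, sat_exset, sat_allset).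

(** Read off an arbitrary structure, so that the lemmas below apply to the coloured one. *)
Definition members : {set {set univ A}} := [set X | spred 0 (in_tuple [:: X])].
Definition colour_class q : {set univ A} := [set a | srel q (in_tuple [:: a])].

Lemma sat_mem fv sv X : sat fv sv (f_mem X) = (sv X \in members).
Proof. by rewrite /f_mem -lock inE. Qed.

Lemma sat_sub fv sv X Y : sat fv sv (f_sub X Y) = (sv X \subset sv Y).
Proof.
rewrite /f_sub -lock sat_all; apply/forallP/subsetP=> XY a.
  by move=> aX; have := XY a; rewrite sat_imp /= aX.
by rewrite sat_imp /=; apply/implyP/XY.
Qed.

Lemma sat_eq fv sv X Y : sat fv sv (f_eq X Y) = (sv X == sv Y).
Proof. by rewrite /f_eq -lock sat_and !sat_sub eqEsubset. Qed.

Lemma sat_proper fv sv X Y : sat fv sv (f_proper X Y) = (sv X \proper sv Y).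
Proof. by rewrite /f_proper -lock sat_and sat_not !sat_sub. Qed.

Lemma sat_meet fv sv X Y : sat fv sv (f_meet X Y) = (sv X :&: sv Y != set0).
Proof.
rewrite /f_meet -lock sat_ex; apply/existsP/set0Pn=> -[a] aXY; exists a; first by rewrite inE.
by move: aXY; rewrite inE.
Qed.

Lemma sat_nonempty fv sv X : sat fv sv (f_nonempty X) = (sv X != set0).
Proof. by rewrite /f_nonempty -lock sat_ex; apply/existsP/set0Pn=> -[a aX]; exists a. Qed.

Ltac sat_upd :=
  repeat (rewrite upd_eq || (rewrite upd_neq; [|by lia])).

Lemma sat_overlap fv sv X Y : sat fv sv (f_overlap X Y) = overlap (sv X) (sv Y).
Proof. by rewrite /f_overlap -lock !satE sat_meet !sat_sub. Qed.

Lemma sat_strong fv sv X : sat fv sv (f_strong X) = strong members (sv X).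
Proof.
rewrite /f_strong -lock !satE sat_mem; congr (_ && _); apply: eq_forallb => Y.
by rewrite !satE sat_mem sat_overlap; sat_upd.
Qed.

Lemma sat_child fv sv X Y : sat fv sv (f_child X Y) = child members (sv X) (sv Y).
Proof.
rewrite /f_child -lock !satE !sat_strong sat_proper; do 3 congr (_ && _); apply: eq_forallb => Z.
by rewrite !satE sat_strong !sat_proper; sat_upd.
Qed.

Lemma sat_inner fv sv X : sat fv sv (f_inner X) = inner members (sv X).
Proof.
rewrite /f_inner -lock !satE sat_strong; congr (_ && _); apply: eq_existsb => Y.
by rewrite sat_child; sat_upd.
Qed.

Lemma sat_splits fv sv t X :
  sat fv sv (f_splits t X) = splits members (sv t) (sv X).
Proof.
rewrite /f_splits -lock !satE sat_nonempty sat_sub; do 2 congr (_ && _); apply: eq_forallb => c.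
by rewrite !satE sat_child sat_sub sat_meet negbK setI_eq0; sat_upd.
Qed.

Lemma sat_degenerate fv sv t :
  sat fv sv (f_degenerate t) = degenerate members (sv t).
Proof.
rewrite /f_degenerate -lock !satE sat_inner; congr (_ && _); apply: eq_forallb => X.
by rewrite !satE sat_splits sat_mem; sat_upd.
Qed.

Lemma sat_btw fv sv x y z :
  sat fv sv (f_btw x y z) = btw members (sv x) (sv y) (sv z).
Proof.
rewrite /f_btw -lock !satE sat_eq; congr [&& _, _, _ & _].
- by apply: eq_existsb => Z; rewrite !satE !sat_child; sat_upd.
- by apply: eq_forallb => Z; rewrite !satE !sat_sub sat_mem; sat_upd.
- by apply: eq_existsb => Z; rewrite !satE !sat_sub sat_mem; sat_upd.
Qed.

Lemma sat_before fv sv f x y :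
  sat fv sv (f_before f x y) = before members (sv f) (sv x) (sv y).
Proof. by rewrite /f_before -lock !satE !sat_eq sat_btw. Qed.

Lemma sat_first_child fv sv t f :
  sat fv sv (f_first_child t f) = first_child members (sv t) (sv f).
Proof.
rewrite /f_first_child -lock sat_and sat_child; congr (_ && _); rewrite sat_allset.
apply: eq_forallb => x; rewrite sat_allset; apply: eq_forallb => y.
rewrite sat_allset; apply: eq_forallb => z.
by rewrite !satE !sat_child !sat_before sat_eq sat_btw implyNb; sat_upd.
Qed.

Lemma sat_btw_closed fv sv t X :
  sat fv sv (f_btw_closed t X) = btw_closed members (sv t) (sv X).
Proof.
rewrite /f_btw_closed -lock sat_allset.
apply: eq_forallb => x; rewrite sat_allset; apply: eq_forallb => y.
rewrite sat_allset; apply: eq_forallb => z.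
by rewrite !satE !sat_child !sat_sub sat_btw; sat_upd.
Qed.

Lemma sat_linear fv sv t : sat fv sv (f_linear t) = linear members (sv t).
Proof.
rewrite /f_linear -lock !satE sat_inner sat_degenerate; congr [&& _, _, _ & _].
  by apply: eq_existsb => f; rewrite sat_first_child; sat_upd.
by apply: eq_forallb => X; rewrite !satE sat_splits sat_btw_closed sat_mem; sat_upd.
Qed.

Lemma holds_has_wp_tree : holds A f_has_wp_tree = has_wp_tree members.
Proof.
rewrite /holds sat_and; congr (_ && _); rewrite sat_allset.
  apply: eq_forallb => X; rewrite !satE sat_mem sat_strong; congr (_ ==> (_ || _)).
  apply: eq_existsb => t.
  by rewrite !satE sat_splits sat_degenerate sat_linear sat_btw_closed; sat_upd.
apply: eq_forallb => x; rewrite sat_allset; apply: eq_forallb => y.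
rewrite sat_allset; apply: eq_forallb => z; rewrite !satE sat_btw; congr (_ ==> _).
by apply: eq_existsb => t; rewrite !satE sat_child sat_linear; sat_upd.
Qed.

Lemma sat_even fv sv i X :
  sat fv sv (f_even i X) = ~~ odd #|sv X :&: colour_class i|.
Proof.
rewrite /f_even -lock sat_exset.
have allE Y : sat fv (upd sv X.+1 Y)
    (FAll 0 (FIff (FIn 0 X.+1) (FAnd (FIn 0 X) (FRel i [:: 0])))) =
    (Y == sv X :&: colour_class i).
  rewrite sat_all; apply/forallP/eqP=> [YP|-> a]; first apply/setP=> a.
    have := YP a; rewrite sat_iff sat_and /=; sat_upd.
    by rewrite !inE => /eqP.
  by rewrite sat_iff sat_and /=; sat_upd; rewrite !inE.
apply/existsP/idP=> [[Y]|oX].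
  by rewrite sat_and allE /=; sat_upd; move=> /andP[/eqP->].
by exists (sv X :&: colour_class i); rewrite sat_and allE eqxx /=; sat_upd.
Qed.

Lemma sat_rep fv sv i x X a : fv x = Some a ->
  sat fv sv (f_rep i x X) = rep members (colour_class i) a (sv X).
Proof.
move=> fx; rewrite /f_rep -lock !satE sat_strong sat_even (sat_in _ _ fx); congr [&& _, _, _ & _].
apply: eq_forallb => Y.
by rewrite !satE sat_strong sat_even sat_proper (sat_in _ _ fx) negbK; sat_upd.
Qed.

End Satisfaction.

(** * The transduction *)

Section TrackedIsomorphisms.
Variable A : structure.
Implicit Types o : tracked A.

Lemma tiso_refl o : tiso o o.
Proof.
exists id; split=> // [|q r t|q r t]; first by exists id.
  by congr srel; apply: val_inj; apply: map_id.
by congr spred; apply: val_inj; rewrite /= -[RHS]map_id; apply: eq_map => X; apply: imset_id.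
Qed.

Lemma tiso_sym o1 o2 : tiso o1 o2 -> tiso o2 o1.
Proof.
case=> f [[g fK gK] fr fp ft]; exists g; split=> [|q r t|q r t|b].
- by exists f.
- rewrite -fr; congr srel; apply: val_inj => /=.
  by rewrite -map_comp -[RHS]map_id; apply: eq_map => x /=; rewrite gK.
- rewrite -fp; congr spred; apply: val_inj => /=.
  rewrite -map_comp -[RHS]map_id; apply: eq_map => X /=.
  by rewrite -imset_comp -[RHS]imset_id; apply: eq_imset => x /=; rewrite gK.
- by rewrite -ft gK.
Qed.

Lemma tiso_trans o1 o2 o3 : tiso o1 o2 -> tiso o2 o3 -> tiso o1 o3.
Proof.
case=> f [fb fr fp ft] [g [gb gr gp gt]]; exists (g \o f); split=> [|q r t|q r t|b].
- exact: bij_comp.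
- rewrite -fr -gr; congr srel; apply: val_inj => /=.
  by rewrite -map_comp.
- rewrite -fp -gp; congr spred; apply: val_inj => /=.
  by rewrite -map_comp; apply: eq_map => X /=; rewrite imset_comp.
- by rewrite /= gt ft.
Qed.

Lemma tiso_compose (o1 : tracked A) (o2 o2' : tracked (projT1 o1)) :
  tiso o2 o2' -> tiso (compose_tracked o2) (compose_tracked o2').
Proof. by case=> f [fb fr fp ft]; exists f; split=> //= b; rewrite ft. Qed.

End TrackedIsomorphisms.

(* [run] without the isomorphisms; [tr] accumulates the provenance. *)
Fixpoint reaches (T : Type) (tau : transduction) (B : structure)
    (tr : univ B -> option T) (o : {B' : structure & univ B' -> option T}) : Prop :=
  match tau with
  | [::] => o = existT _ B tr
  | t :: tau' => exists C (o1 : tracked B), step t C = Some o1 /\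
      reaches tau' (fun x => obind tr (projT2 o1 x)) o
  end.

(** The isomorphisms allowed after each step of [run] can be postponed to the end. The induction
    needs an arbitrary start [B] with provenance [tr], since [reaches] accumulates provenance while
    [run] composes it on the way back. *)
Lemma run_reaches (A B : structure) tau (tr : univ B -> option (univ A)) (o : tracked A) :
  (exists2 o2 : tracked B, run tau o2 &
     tiso (@compose_tracked A (existT _ B tr) o2) o) <->
  (exists2 o', reaches tau tr o' & tiso o' o).
Proof.
elim: tau B tr => [|t tau IH] B tr /=.
  split=> [[o2 iso2 iso]|[_ -> iso]].
    exists (existT _ B tr) => //; apply: tiso_trans iso.
    exact: (@tiso_compose A (existT _ B tr) _ _ iso2).
  exists (existT _ B (fun a => Some a)) => //; exact: tiso_refl.
(* Composition of provenances is associative pointwise, so an isomorphism takes the place of an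
   equation. *)
have assoc (o1 : tracked B) (o3 : tracked (projT1 o1)) :
    tiso (@compose_tracked A (existT _ (projT1 o1) (fun x => obind tr (projT2 o1 x))) o3)
         (@compose_tracked A (existT _ B tr) (compose_tracked o3)).
  have [f [fb fr fp ft]] := tiso_refl o3; exists f; split=> // b /=.
  by rewrite ft; case: (projT2 o3 b).
split=> [[o2 [C [o1 [so1 [o3 [run3 iso3]]]]] iso]|[o' [C [o1 [so1 re]]] iso]].
  have [|o' re iso'] := (IH (projT1 o1) (fun x => obind tr (projT2 o1 x))).1.
    exists o3 => //; apply: tiso_trans (assoc _ _) (tiso_trans _ iso).
    exact: (@tiso_compose A (existT _ B tr) _ _ iso3).
  by exists o' => //; exists C, o1.
have [|o3 run3 iso3] := (IH (projT1 o1) (fun x => obind tr (projT2 o1 x))).2.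
  by exists o'.
exists (compose_tracked o3); last exact: tiso_trans (tiso_sym (assoc _ _)) iso3.
by exists C, o1; split=> //; exists o3; split=> //; apply: tiso_refl.
Qed.

Lemma run_tiso A tau (o o' : tracked A) : run tau o -> tiso o o' -> run tau o'.
Proof.
case: tau => [|t tau] /=; first exact: tiso_trans.
move=> [C [o1 [so1 [o2 [run2 iso]]]]] iso'; exists C, o1; split=> //.
by exists o2; split=> //; apply: tiso_trans iso'.
Qed.

Lemma runP A tau (o : tracked A) :
  run tau o <-> exists2 o', reaches tau (fun a : univ A => Some a) o' & tiso o' o.
Proof.
have eta (o1 : tracked A) :
    tiso (@compose_tracked A (existT _ A (fun a => Some a)) o1) o1.
  have [f [fb fr fp ft]] := tiso_refl o1; exists f; split=> // b /=.
  by rewrite ft; case: (projT2 o1 b).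
split=> [ro|/run_reaches[o2 run2 iso]].
  by apply/run_reaches; exists o.
exact: run_tiso run2 (tiso_trans (tiso_sym (eta o2)) iso).
Qed.

Section ReachesStep.
Variables (T : Type) (tau : transduction) (B : structure) (tr : univ B -> option T).
Implicit Types o : {B' : structure & univ B' -> option T}.

Lemma reaches_colour q o : reaches (TColour q :: tau) tr o <->
  exists C, reaches (B := colour_structure C q) tau tr o.
Proof.
split=> [[C [_ [[<-] re]]]|[C re]]; exists C => //.
by exists (existT _ (colour_structure C q) (fun a => Some a)).
Qed.

Lemma reaches_filter f o :
  reaches (TFilter f :: tau) tr o <-> holds B f /\ reaches tau tr o.
Proof.
split=> [[C [o1 [/=]]]|[h re]]; first by case: ifP => // h [<-].
by exists set0, (existT _ B (fun a => Some a)); rewrite /= h.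
Qed.

Lemma reaches_interp rs ss o : reaches (TInterp rs ss :: tau) tr o <->
  reaches (B := interp_structure B rs ss) tau tr o.
Proof.
split=> [[C [_ [[<-] re]]]|re] //.
by exists set0, (existT _ (interp_structure B rs ss) (fun a => Some a)).
Qed.

Lemma reaches_copy k c o : reaches (TCopy k c :: tau) tr o <->
  reaches (B := copy_structure B k c) tau
    (fun x => obind tr (if x.2 == ord0 then Some x.1 else None)) o.
Proof.
split=> [[C [_ [[<-] re]]]|re] //.
by exists set0; eexists; split; first reflexivity.
Qed.

Lemma reaches_restrict f o : reaches (TRestrict f :: tau) tr o <->
  reaches (B := restrict_structure B f) tau (fun b => tr (val b)) o.
Proof.
split=> [[C [_ [[<-] re]]]|re] //.
by exists set0; eexists; split; first reflexivity.
Qed.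

End ReachesStep.

(** * The steps of the transduction *)

Definition node_formula i :=
  FExSet 0 (FAnd (FRel (i + 4) [:: 0]) (FAnd (f_rep i 0 0) (FIn 1 0))).

(** Computed while the universe is still [U]: relation [i] lists the members of the node denoted by
    the [i]-th copy, and relation 0, equality, those of the leaf. *)
Definition member_rels : seq (nat * nat * formula) :=
  (0, 2, FEq 0 1) :: [seq (i, 2, node_formula i) | i <- [:: 1; 2; 3]].

Definition tree_preds : seq (nat * nat * formula) :=
  [:: (0, 2, FAnd (f_strong 0) (FAnd (f_strong 1) (f_sub 1 0)));
      (1, 1, f_degenerate 0); (2, 3, f_btw 0 1 2)].

(* The offset avoids a clash with the names in [member_rels]. *)
Definition copy_name i := i + 10.

(** An original [x] is described by relation 0, and its [i]-th copy by relation [i] of the original,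
    here [z]. The seed [FNot (FEq b b)] is falsity. *)
Definition f_label b x := let z := (b + x).+1 in
  FOr (FRel 0 [:: b; x])
    (foldr (fun i => FOr (FEx z (FAnd (FRel (copy_name i) [:: z; x]) (FRel i [:: z; b]))))
       (FNot (FEq b b)) [:: 1; 2; 3]).

Definition f_nodeset x X :=
  locked (FAll x.+1 (FIff (FIn x.+1 X) (f_label x.+1 x))).

(** The interpretation has dropped [SET]; the ancestor predicate at a repeated argument recognises
    the strong sets. *)
Definition f_unique :=
  FAllSet 0 (FImp (FSet 0 [:: 0; 0]) (FEx 0 (FAnd (f_nodeset 0 0)
    (FAll 1 (FImp (f_nodeset 1 0) (FEq 1 0)))))).

(** Element variable [i] and set variable [i] are different variables: the latter names the set
    denoted by the former. *)
Definition f_lift q r :=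
  foldr (fun i f => FExSet i (FAnd (f_nodeset i i) f)) (FSet q (iota 0 r)) (iota 0 r).

Definition tree_rels : seq (nat * nat * formula) :=
  [:: (0, 2, f_lift 0 2); (1, 1, f_lift 1 1); (2, 3, f_lift 2 3)].

(** Reflexivity of the ancestor relation singles out the elements that denote a node. *)
Definition f_node := FRel 0 [:: 0; 0].

(** The first filter precedes the interpretation, which forgets [SET]; the second follows copying,
    as it speaks of the copies. *)
Definition wp_transduction : transduction :=
  [:: TColour 1; TColour 2; TColour 3; TColour 5; TColour 6; TColour 7;
      TFilter f_has_wp_tree; TInterp member_rels tree_preds; TCopy 3 copy_name;
      TFilter f_unique; TInterp tree_rels [::]; TRestrict f_node].

Lemma srel_interp A rs ss q r (t : r.-tuple (univ A)) :
  @srel (interp_structure A rs ss) q r t =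
  if lookup rs q r is Some f then holds_fo f t else false.
Proof. by []. Qed.

Lemma spred_interp A rs ss q r (t : r.-tuple {set univ A}) :
  @spred (interp_structure A rs ss) q r t =
  if lookup ss q r is Some f then holds_mso f t else false.
Proof. by []. Qed.

Lemma spred_copy A k c q r (t : r.-tuple {set univ A * 'I_k.+1}) :
  @spred (copy_structure A k c) q r t =
  all (fun X : {set univ A * 'I_k.+1} => X \subset [set x | x.2 == ord0]) t &&
  spred q (map_tuple (fun X : {set univ A * 'I_k.+1} => fst @: X) t).
Proof. by []. Qed.

Lemma srel_restrict A f q r (t : r.-tuple (univ (restrict_structure A f))) :
  @srel (restrict_structure A f) q r t = srel q (map_tuple val t).
Proof. by []. Qed.

Lemma spred_restrict A f q r (t : r.-tuple {set univ (restrict_structure A f)}) :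
  @spred (restrict_structure A f) q r t = spred q (map_tuple
    (fun X : {set {a : univ A | restrict_pred f a}} => val @: X) t).
Proof. by []. Qed.

Lemma srel_tree (U : finType) (S : {set {set U}}) lam lt q r
    (t : r.-tuple (univ (tree_structure S lam lt))) :
  @srel (tree_structure S lam lt) q r t =
  match q, [seq val x | x <- val t] with
  | 0, [:: u; v] => ancestor S u v
  | 1, [:: u] => inner S u && label_eqb (lam u) DEGENERATE
  | 2, [:: x; y; z] => (lt x y && lt y z) || (lt z y && lt y x)
  | _, _ => false
  end.
Proof. by []. Qed.

Definition ancestor_or_self (U : finType) (S : {set {set U}}) (X Y : {set U}) :=
  [&& strong S X, strong S Y & Y \subset X].

Definition tree_relation (U : finType) (S : {set {set U}}) q (l : seq {set U}) :=
  match q, l with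
  | 0, [:: X; Y] => ancestor_or_self S X Y
  | 1, [:: X] => degenerate S X
  | 2, [:: x; y; z] => btw S x y z
  | _, _ => false
  end.

(* For the concrete [related] and [ns] below, checking the conversions of this
   section would take very long; hence [B] and [nd]. *)
Section TreeIsomorphism.
Variables (U : finType) (S : {set {set U}}).
Variables (lam : {set U} -> label) (lt : rel {set U}).
Variables (B : structure) (nd : univ B -> {set U}) (track : univ B -> option U).
Hypothesis HA : agrees S lam lt.
Hypothesis nd_unique : forall X, strong S X -> exists x, nd x = X /\ forall y, nd y = X -> y = x.
Hypothesis nd_srel : forall q r (t : r.-tuple (univ B)),
  srel q t = tree_relation S q [seq nd x | x <- val t].
Hypothesis nd_spred : forall q r (t : r.-tuple {set univ B}), spred q t = false.
Hypothesis nd_track : forall x, strong S (nd x) -> track x = [pick a | nd x == [set a]].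

Lemma restrict_predE x : restrict_pred f_node x = strong S (nd x).
Proof.
rewrite /restrict_pred /holds_fo /f_node (@sat_rel2 B _ _ 0 0 0 x x) //.
by rewrite nd_srel /= /ancestor_or_self subxx andbT andbb.
Qed.

(** [nd_unique] makes [nd] a bijection from the kept elements onto the nodes. *)
Lemma restrict_tiso : tiso (A := setsys_structure S)
  (existT _ (restrict_structure B f_node) (fun x => track (val x)))
  (tree_tracked S lam lt).
Proof.
have nd_strong (x : univ (restrict_structure B f_node)) : strong S (nd (val x)).
  by rewrite -restrict_predE; apply: valP x.
pose f x : univ (tree_structure S lam lt) := Sub (nd (val x)) (nd_strong x).
have valf x : val (f x) = nd (val x) by [].
have [deg_ag btw_ag] := HA.
exists f; split=> [|q r t|q r t|b].
- have inj_f : injective f.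
    move=> x y /(congr1 val); rewrite !valf => xy; apply: val_inj.
    by have [z [_ zu]] := nd_unique (nd_strong y); rewrite (zu (val y)) // (zu (val x)).
  have /fin_all_exists[g gK] (Y : univ (tree_structure S lam lt)) : exists x, f x = Y.
    have [x [xY _]] := nd_unique (valP Y).
    have sx : restrict_pred f_node x by rewrite restrict_predE xY (valP Y).
    by exists (exist _ x sx); apply: val_inj; rewrite valf.
  by exists g => // x; apply: inj_f; rewrite gK.
- have fE : [seq val x | x <- val (map_tuple f t)] = [seq nd (val x) | x <- val t].
    by rewrite -map_comp.
  have valE : [seq nd x | x <- val (map_tuple val t)] = [seq nd (val x) | x <- val t].
    by rewrite -map_comp.
  rewrite [LHS]srel_tree fE [RHS]srel_restrict nd_srel valE /tree_relation.
  have : all (strong S) [seq nd (val x) | x <- val t].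
    by apply/allP=> _ /mapP[x _ ->]; apply: nd_strong.
  case: q => [|[|[|q]]] //; move: [seq _ | _ <- _] => [|u [|v [|w [|? ?]]]] //=.
  + by case/and3P=> su sv _; rewrite ancestorE // /ancestor_or_self su sv.
  + by rewrite andbT => su; rewrite deg_ag.
  + by rewrite -btw_ag.
- by rewrite [RHS]spred_restrict nd_spred.
by rewrite /= nd_track; [by []|exact: nd_strong].
Qed.

End TreeIsomorphism.

(** * The output for fixed colours *)

Section Output.
Variables (U : finType) (S : {set {set U}}) (C : nat -> {set U}).

Definition coloured : structure :=
  let A1 := @colour_structure (setsys_structure S) (C 1) 1 in
  let A2 := @colour_structure A1 (C 2) 2 in
  let A3 := @colour_structure A2 (C 3) 3 in
  let A5 := @colour_structure A3 (C 5) 5 in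
  let A6 := @colour_structure A5 (C 6) 6 in
  @colour_structure A6 (C 7) 7.

Definition membered : structure := interp_structure coloured member_rels tree_preds.
Definition copied : structure := copy_structure membered 3 copy_name.
Definition related : structure := interp_structure copied tree_rels [::].

Lemma members_coloured : @members coloured = S.
Proof. by apply/setP=> X; rewrite inE. Qed.

Lemma colour_class_coloured q : q \in [:: 1; 2; 3; 5; 6; 7] ->
  @colour_class coloured q = C q.
Proof. by rewrite !inE; do ![case/orP] => /eqP->; apply/setP=> a; rewrite inE. Qed.

Lemma srel_membered (i : 'I_4) (a b : U) :
  @srel membered i _ (in_tuple [:: a; b]) = (b \in nodeset S C (a, i)).
Proof.
have nodeE j : j \in [:: 1; 2; 3] -> lookup member_rels j 2 = Some (node_formula j) ->
    @srel membered j _ (in_tuple [:: a; b]) =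
    [exists X, [&& a \in C (j + 4), rep S (C j) a X & b \in X]].
  move=> jI /= ->; rewrite /holds_fo /node_formula sat_exset.
  apply: eq_existsb => X; rewrite !sat_and; congr [&& _, _ & _].
    rewrite -(@colour_class_coloured (j + 4)) ?inE //.
    by move: jI; rewrite !inE; do ![case/orP] => /eqP->.
  rewrite (@sat_rep coloured _ _ j 0 0 a) // members_coloured colour_class_coloured //.
  by move: jI; rewrite !inE; do ![case/orP] => /eqP->.
rewrite /nodeset; case: i => [[|[|[|[|//]]]] ltn4]; last 3 first.
- by rewrite [RHS]/= inE; apply: (nodeE 1).
- by rewrite [RHS]/= inE; apply: (nodeE 2).
- by rewrite [RHS]/= inE; apply: (nodeE 3).
by rewrite /= /holds_fo /= !inE eq_sym.
Qed.

Definition originals (N : {set U}) : {set U * 'I_4} :=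
  [set y | (y.2 == ord0) && (y.1 \in N)].

Lemma fst_originals N : fst @: originals N = N.
Proof.
apply/setP=> a; apply/imsetP/idP=> [[y]|aN]; first by rewrite inE => /andP[_] ? ->.
by exists (a, ord0); rewrite ?inE ?eqxx.
Qed.

Lemma originals_inj : injective originals.
Proof.
exact: (@can_inj _ _ originals (fun X : {set U * 'I_4} => fst @: X) fst_originals).
Qed.

Lemma originalsP (X : {set U * 'I_4}) :
  reflect (X = originals (fst @: X)) (X \subset [set x | x.2 == ord0]).
Proof.
apply: (iffP subsetP) => [X0|-> y]; last by rewrite !inE => /andP[].
apply/setP=> -[a i]; rewrite inE /=; apply/idP/andP=> [aX|[/eqP-> /imsetP[[b j] bX ->]]].
  by have := X0 _ aX; rewrite inE /= => i0; split=> //; apply/imsetP; exists (a, i).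
by have := X0 _ bX; rewrite inE => /eqP /= j0; rewrite -j0.
Qed.

Lemma srel_copied_old q (x y : U * 'I_4) : q < 10 ->
  @srel copied q _ (in_tuple [:: x; y]) =
  [&& x.2 == ord0, y.2 == ord0 & @srel membered q _ (in_tuple [:: x.1; y.1])].
Proof.
move=> q10; rewrite /copied /copy_structure {1}/srel.
case: existsP => [[i /andP[_ /eqP iq]]|_].
  by have := leq_addl i 10; rewrite -/(copy_name i) iq leqNgt q10.
by rewrite andbF /= andbT -andbA; congr [&& _, _ & _].
Qed.

Lemma srel_copied_new (i : 'I_4) (x y : U * 'I_4) : i != ord0 ->
  @srel copied (copy_name i) _ (in_tuple [:: x; y]) =
  [&& x.2 == ord0, y.1 == x.1 & y.2 == i].
Proof.
move=> i0; rewrite /copied /copy_structure {1}/srel.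
case: existsP => [_|[]]; last by exists i; rewrite i0 eqxx.
rewrite /= /copy_name eqn_add2r; congr [&& _, _ & _].
by rewrite val_eqE; case: (eqVneq y.2 i) => [->|]; rewrite ?i0 ?andbF.
Qed.

Lemma spred_copied q r (t : r.-tuple {set U}) :
  @spred copied q r (map_tuple originals t) = @spred membered q r t.
Proof.
rewrite /copied spred_copy.
have -> : all (fun X : {set U * 'I_4} => X \subset [set x | x.2 == ord0])
              (map_tuple originals t).
  by apply/allP=> X /mapP[N _ ->]; apply/originalsP; rewrite fst_originals.
congr spred; apply: val_inj => /=; rewrite -map_comp -[RHS]map_id.
by apply: eq_map => N /=; rewrite fst_originals.
Qed.

Definition ns : U * 'I_4 -> {set U} := nodeset S C.

Definition unique_nodes :=
  forall X, strong S X -> exists x, ns x = X /\ forall y, ns y = X -> y = x.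

Lemma sat_label (fv : nat -> option (univ copied)) sv b x (y v : U * 'I_4) :
  fv b = Some y -> fv x = Some v ->
  @sat copied fv sv (f_label b x) = (y \in originals (ns v)).
Proof.
move=> fb fx; pose z := (b + x).+1.
have zb (w : univ copied) : upd fv z (Some w) b = Some y by rewrite upd_neq //; lia.
have zx (w : univ copied) : upd fv z (Some w) x = Some v by rewrite upd_neq //; lia.
have exE (i : 'I_4) : i != ord0 ->
    @sat copied fv sv (FEx z (FAnd (FRel (copy_name i) [:: z; x]) (FRel i [:: z; b]))) =
    [&& v.2 == i, y.2 == ord0 & y.1 \in nodeset S C (v.1, i)].
  move=> i0; rewrite sat_ex; apply/existsP/and3P=> [[w]|[/eqP vi y0 yv]].
    rewrite sat_and (sat_rel2 _ _ (upd_eq _ _ _) (zx w)) (sat_rel2 _ _ (upd_eq _ _ _) (zb w)).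
    rewrite srel_copied_new // srel_copied_old; last by have := ltn_ord i; lia.
    by rewrite srel_membered => /andP[/and3P[_ /eqP-> ->] /and3P[]].
  exists ((v.1, ord0) : U * 'I_4).
  rewrite sat_and (sat_rel2 _ _ (upd_eq _ _ _) (zx _)) (sat_rel2 _ _ (upd_eq _ _ _) (zb _)).
  rewrite srel_copied_new //.
  rewrite srel_copied_old; last by have := ltn_ord i; lia.
  by rewrite srel_membered vi y0 yv !eqxx.
rewrite /f_label -/z [foldr _ _ _]/= !sat_or.
rewrite (exE (@Ordinal 4 1 isT)) // (exE (@Ordinal 4 2 isT)) // (exE (@Ordinal 4 3 isT)) //.
rewrite sat_not (sat_rel2 _ _ fb fx) srel_copied_old // (srel_membered ord0).
rewrite [sat _ _ _]/= fb eqxx orbF.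
have -> : nodeset S C (y.1, ord0) = [set y.1] by rewrite /nodeset eqxx.
rewrite [RHS]inE in_set1 /ns; case: v {fx zx exE} => c i.
case: (y.2 == ord0); rewrite ?andbF //= -!val_eqE /=.
case: i => [[|[|[|[|//]]]] i4]; rewrite /= ?orbF; last 3 first.
- by congr (_ \in nodeset S C (_, _)); apply: val_inj.
- by congr (_ \in nodeset S C (_, _)); apply: val_inj.
- by congr (_ \in nodeset S C (_, _)); apply: val_inj.
by rewrite /nodeset /= in_set1 eq_sym.
Qed.

Lemma sat_nodeset (fv : nat -> option (univ copied)) sv x X (v : U * 'I_4) :
  fv x = Some v ->
  @sat copied fv sv (f_nodeset x X) = (sv X == originals (ns v)).
Proof.
move=> fx; rewrite /f_nodeset -lock sat_all.
have iffE (y : univ copied) : @sat copied (upd fv x.+1 (Some y)) sv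
    (FIff (FIn x.+1 X) (f_label x.+1 x)) = ((y \in sv X) == (y \in originals (ns v))).
  rewrite sat_iff (@sat_in _ _ _ _ _ y) ?upd_eq //.
  by rewrite (@sat_label _ _ _ _ y v) ?upd_eq ?upd_neq //; lia.
apply/forallP/eqP=> [XP|sX y]; last by rewrite iffE sX.
by apply/setP=> y; have := XP y; rewrite iffE => /eqP.
Qed.

(** [f_nodeset] has a single solution in the set variable, so the quantifier acts as a
    substitution. *)
Lemma sat_ex_nodeset (fv : nat -> option (univ copied)) sv x X f (v : U * 'I_4) :
  fv x = Some v ->
  @sat copied fv sv (FExSet X (FAnd (f_nodeset x X) f)) =
  @sat copied fv (upd sv X (originals (ns v))) f.
Proof.
move=> fx; rewrite sat_exset; apply/existsP/idP=> [[Y]|sf].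
  by rewrite sat_and (sat_nodeset _ _ fx) upd_eq => /andP[/eqP->].
by exists (originals (ns v)); rewrite sat_and (sat_nodeset _ _ fx) upd_eq eqxx.
Qed.

Lemma sat_set A fv sv q Xs :
  @sat A fv sv (FSet q Xs) = spred q (in_tuple (map sv Xs)).
Proof. by []. Qed.

Lemma spred_membered q r (t : r.-tuple {set U}) : @spred membered q r t =
  tree_relation S q (val t).
Proof.
case: t => s sr; have rs := eqP sr; subst r; rewrite /membered spred_interp.
case: q => [|[|[|q]]]; case: s sr => [|a [|b [|c [|d s]]]] sr //=; rewrite /holds_mso.
- by rewrite !sat_and !sat_strong sat_sub members_coloured.
- by rewrite sat_degenerate members_coloured.
- by rewrite sat_btw members_coloured.
Qed.

Lemma srel_related q r (t : r.-tuple (U * 'I_4)) : @srel related q r t =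
  tree_relation S q [seq ns x | x <- val t].
Proof.
have lifted k n (s : n.-tuple {set U}) (s' : n.-tuple {set U * 'I_4}) :
    val s' = map originals s -> @spred copied k n s' = @spred membered k n s.
  by move=> ss; rewrite -spred_copied; congr spred; apply: val_inj.
case: t => s sr; have rs := eqP sr; subst r; rewrite /related srel_interp.
case: q => [|[|[|q]]]; case: s sr => [|a [|b [|c [|d s]]]] sr //=; rewrite /holds_fo.
- rewrite (@sat_ex_nodeset _ _ _ _ _ a) // (@sat_ex_nodeset _ _ _ _ _ b) // sat_set.
  exact: etrans (lifted 0 2 [tuple ns a; ns b]
    [tuple originals (ns a); originals (ns b)] erefl)
    (spred_membered _ _).
- rewrite (@sat_ex_nodeset _ _ _ _ _ a) // sat_set.
  exact: etrans (lifted 1 1 [tuple ns a]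
    [tuple originals (ns a)] erefl)
    (spred_membered _ _).
- rewrite (@sat_ex_nodeset _ _ _ _ _ a) // (@sat_ex_nodeset _ _ _ _ _ b) //
    (@sat_ex_nodeset _ _ _ _ _ c) // sat_set.
  exact: etrans (lifted 2 3 [tuple ns a; ns b; ns c]
    [tuple originals (ns a); originals (ns b); originals (ns c)] erefl)
    (spred_membered _ _).
Qed.

Lemma sat_strong_originals (X : {set U * 'I_4}) :
  @sat copied (@no_fv copied) (upd (@no_sv copied) 0 X) (FSet 0 [:: 0; 0]) =
  (X \subset [set x | x.2 == ord0]) && strong S (fst @: X).
Proof.
rewrite sat_set /copied spred_copy spred_membered /=.
by rewrite /ancestor_or_self subxx !andbT !andbb.
Qed.

Lemma sat_eq_elt (fv : nat -> option (univ copied)) sv x y (a b : U * 'I_4) :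
  fv x = Some a -> fv y = Some b -> @sat copied fv sv (FEq x y) = (a == b).
Proof. by move=> /= -> ->. Qed.

Lemma sat_exists_unique (X : {set U * 'I_4}) :
  @sat copied (@no_fv copied) (upd (@no_sv copied) 0 X)
      (FEx 0 (FAnd (f_nodeset 0 0) (FAll 1 (FImp (f_nodeset 1 0) (FEq 1 0))))) <->
  exists x, X = originals (ns x) /\ forall y, X = originals (ns y) -> y = x.
Proof.
have xE (x y : U * 'I_4) :
    @sat copied (upd (upd (@no_fv copied) 0 (Some x)) 1 (Some y))
      (upd (@no_sv copied) 0 X) (FImp (f_nodeset 1 0) (FEq 1 0)) =
    ((X == originals (ns y)) ==> (y == x)).
  by rewrite sat_imp (@sat_nodeset _ _ _ _ y) // (@sat_eq_elt _ _ _ _ y x) // upd_eq.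
rewrite sat_ex; split=> [/existsP[x]|[x [XE xu]]].
  rewrite sat_and (@sat_nodeset _ _ _ _ x) // sat_all => /andP[/eqP XE /forallP xu].
  exists x; split=> // y XE'; have := xu y; rewrite xE => /implyP/(_ (introT eqP XE')).
  by move/eqP.
apply/existsP; exists x; rewrite sat_and (@sat_nodeset _ _ _ _ x) // upd_eq XE eqxx sat_all.
by apply/forallP=> y; rewrite -XE xE; apply/implyP=> /eqP/xu->.
Qed.

Lemma holds_unique : holds copied f_unique <-> unique_nodes.
Proof.
rewrite /holds /f_unique sat_allset; split=> [/forallP all_X N sN|all_N].
  have N0 : originals N \subset [set x | x.2 == ord0].
    by apply/originalsP; rewrite fst_originals.
  have := all_X (originals N).
  rewrite sat_imp sat_strong_originals fst_originals sN N0 andbT implyTb.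
  case/sat_exists_unique=> x [/originals_inj-> xu].
  by exists x; split=> // y yx; apply: xu; rewrite yx.
apply/forallP=> X; rewrite sat_imp sat_strong_originals; apply/implyP=> /andP[/originalsP XE sX].
apply/sat_exists_unique; have [x [xX xu]] := all_N _ sX; exists x; rewrite xX; split=> // y.
by rewrite XE => /originals_inj yE; apply: xu; rewrite -yE.
Qed.

Lemma spred_related q r (t : r.-tuple {set univ related}) : spred q t = false.
Proof. by rewrite /related spred_interp. Qed.

Lemma ns_set1 a : ns (a, ord0) = [set a].
Proof. by rewrite /ns /nodeset eqxx. Qed.

(** By uniqueness the only element that denotes [[set c]] is the original [c], so originals and
    leaves coincide among the kept elements. *)
Lemma pick_ns (x : U * 'I_4) : unique_nodes -> strong S (ns x) ->
  (if x.2 == ord0 then Some x.1 else None) = [pick a | ns x == [set a]].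
Proof.
move=> HU sx; have [z [_ zu]] := HU _ sx; case: pickP => [c /eqP nc|none].
  have xc : x = (c, ord0) by rewrite (zu x erefl) (zu (c, ord0)) // ns_set1 nc.
  by rewrite xc eqxx.
case: eqP => // x0; case/eqP: (none x.1).
by rewrite -ns_set1 -x0 -surjective_pairing.
Qed.

(** The idle [obind] is what [reaches] accumulates; with it [reaches_wp_transduction] ends by
    conversion. *)
Definition output : tracked (setsys_structure S) :=
  existT _ (restrict_structure related f_node) (fun b =>
    obind (fun a => Some a) (if (val b).2 == ord0 then Some (val b).1 else None)).

Lemma output_tiso lam lt : agrees S lam lt -> unique_nodes ->
  tiso output (tree_tracked S lam lt).
Proof.
move=> HA HU.
apply: (@restrict_tiso U S lam lt related ns (fun x : U * 'I_4 =>
  obind (fun a => Some a) (if x.2 == ord0 then Some x.1 else None)) HA HU).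
- exact: srel_related.
- exact: spred_related.
by move=> x sx; rewrite -pick_ns //; case: ifP.
Qed.

End Output.

Lemma reaches_wp_transduction (U : finType) (S : {set {set U}})
    (o : tracked (setsys_structure S)) :
  reaches wp_transduction (fun a : univ (setsys_structure S) => Some a) o <->
  has_wp_tree S /\ exists2 C, unique_nodes S C & o = output S C.
Proof.
have wpE C : holds (coloured S C) f_has_wp_tree = has_wp_tree S.
  by rewrite holds_has_wp_tree members_coloured.
rewrite /wp_transduction; split.
  case/reaches_colour=> C1 /reaches_colour[C2 /reaches_colour[C3]].
  case/reaches_colour=> C5 /reaches_colour[C6 /reaches_colour[C7]].
  (* Positions 0 and 4 number no colour and are filled with [set0]. *)
  pose C n := nth set0 [:: set0; C1; C2; C3; set0; C5; C6; C7] n.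
  case/reaches_filter=> wp /reaches_interp/reaches_copy/reaches_filter[un].
  move=> /reaches_interp/reaches_restrict oE.
  split; first by rewrite -(wpE C).
  by exists C; [apply/(holds_unique S C) | exact: oE].
case=> wp [C /(holds_unique S C) un oE].
apply/reaches_colour; exists (C 1); apply/reaches_colour; exists (C 2).
apply/reaches_colour; exists (C 3); apply/reaches_colour; exists (C 5).
apply/reaches_colour; exists (C 6); apply/reaches_colour; exists (C 7).
apply/reaches_filter; split; first by rewrite -(wpE C) in wp.
apply/reaches_interp/reaches_copy/reaches_filter; split; first exact: un.
apply/reaches_interp.
apply/reaches_restrict.
rewrite oE.
reflexivity.
Qed.

Theorem theorem4p3 :
  exists tau : transduction,
    forall (U : finType) (S : {set {set U}}),
      weakly_partitive S ->
      (forall (lam : {set U} -> label) (lt : rel {set U}),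
          is_wp_tree S lam lt ->
          run tau (tree_tracked S lam lt)) /\
      (forall o : tracked (setsys_structure S),
          run tau o ->
          exists (lam : {set U} -> label) (lt : rel {set U}),
            is_wp_tree S lam lt /\ tiso (tree_tracked S lam lt) o).
Proof.
exists wp_transduction => U S [HS _].
have output_tree C lam lt : unique_nodes S C -> agrees S lam lt ->
    tiso (output S C) (tree_tracked S lam lt).
  by move=> uniq ag; apply: output_tiso.
split=> [lam lt T|o /runP[o']].
  (* As each weakly-partitive tree agrees with the definable relations, one output serves all of
     them, whatever their orientation. *)
  have [wp ag] := has_wp_tree_complete HS T; have [C uniq] := exists_nodeset HS.
  apply/runP; exists (output S C); last exact: output_tree.
  by apply/reaches_wp_transduction; split=> //; exists C.
case/reaches_wp_transduction=> wp [C uniq ->] iso.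
have [lam [lt [T ag]]] := has_wp_tree_sound HS wp.
exists lam, lt; split=> //; apply: tiso_trans iso.
by apply: tiso_sym; apply: output_tree ag.
Qed.
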